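(* Let $n\ge2$ and let $\phi\colon[0,\infty)\to[0,\infty)$ be given by $$\phi(s)=\begin{cases}0,& s=0,\\ \left[\log\left(\frac{e}{s}\right)\right]^{-\frac1n}\left[\log\log\left(\frac{e^e}{s}\right)\right]^{-1},&0<s\le1,\\ s,& s\ge1.\end{cases}$$ Then there exists a deformation of bi-conformal energy $H\colon\mathbb R^n\to\mathbb R^n$ (a homeomorphism onto $\mathbb R^n$), with inverse $F=H^{-1}\colon\mathbb R^n\to\mathbb R^n$, and a constant $C$ depending only on $n$, such that: 1. $H(0)=0$ and $H(x)=x$ for $|x|\ge1$; 2. $|H(x_1)-H(x_2)|\le C\,\phi(|x_1-x_2|)$ for all $x_1,x_2\in\mathbb R^n$; 3. $|F(y_1)-F(y_2)|\le C\,\phi(|y_1-y_2|)$ for all $y_1,y_2\in\mathbb R^n$; 4. $\phi$ is the optimal modulus of continuity at the origin for both $H$ and $F$: for every $0\le s<\infty$, $$\omega_H(0,s)=\phi(s)=\omega_F(0,s).$$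
   Context: $|\cdot|$ is the Euclidean norm on $\mathbb R^n$. A deformation of bi-conformal energy between domains $\mathbb X,\mathbb Y\subset\mathbb R^n$ is a homeomorphism $h$ of $\mathbb X$ onto $\mathbb Y$ belonging to the Sobolev class $\mathscr W^{1,n}_{\rm loc}(\mathbb X,\mathbb Y)$ whose inverse $h^{-1}$ belongs to $\mathscr W^{1,n}_{\rm loc}(\mathbb Y,\mathbb X)$. For a homeomorphism $h\colon\mathbb R^n\to\mathbb R^n$, the optimal modulus of continuity at $0$ is $\omega_h(0,s)=\max_{|x|=s}|h(x)-h(0)|$, $s\ge0$. *)

(* Defs.v *)
From HB Require Import structures.
From mathcomp Require Import all_boot all_order all_algebra.
From mathcomp Require Import all_classical all_reals all_analysis.

Set Implicit Arguments.
Unset Strict Implicit.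
Unset Printing Implicit Defensive.

Import Order.TTheory GRing.Theory Num.Theory.
Import numFieldNormedType.Exports.

Local Open Scope classical_set_scope.
Local Open Scope ring_scope.

(* Points of R^n are row vectors 'rV[R]_n.  Their library norm `|x| is the sup
   norm: it gives the usual topology, but is not the Euclidean norm. *)
Definition enorm (R : realType) (n : nat) (x : 'rV[R]_n) : R :=
  Num.sqrt (\sum_(i < n) x ord0 i ^+ 2).

Local Notation RT := measurableTypeR.

Section rV_measurable.
Context {R : realType} {n : nat}.

Definition tuple_of_rV (x : 'rV[R]_n) : n.-tuple (RT R) :=
  [tuple x ord0 i | i < n].
Definition rV_of_tuple (t : n.-tuple (RT R)) : 'rV[R]_n := \row_i tnth t i.

Lemma tuple_of_rVK : cancel tuple_of_rV rV_of_tuple.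
Proof. by move=> x; apply/rowP => i; rewrite mxE tnth_mktuple. Qed.

Lemma rV_of_tupleK : cancel rV_of_tuple tuple_of_rV.
Proof. by move=> t; apply: eq_from_tnth => i; rewrite tnth_mktuple mxE. Qed.

(* The sigma-algebra generated by the coordinates, i.e. the Borel
   sigma-algebra of R^n. *)
Definition rV_measurable : set (set 'rV[R]_n) :=
  preimage_set_system setT tuple_of_rV measurable.

Let rV_sigma_algebra : sigma_algebra setT rV_measurable.
Proof. exact/sigma_algebra_preimage/sigma_algebra_measurable. Qed.

Let rV_measurable0 : rV_measurable set0.
Proof. by case: rV_sigma_algebra. Qed.

Let rV_measurableC A : rV_measurable A -> rV_measurable (~` A).
Proof. by case: rV_sigma_algebra => _ + _ => /[apply]; rewrite setTD. Qed.

Let rV_measurable_bigcup (F : (set 'rV[R]_n)^nat) :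
  (forall i, rV_measurable (F i)) -> rV_measurable (\bigcup_i F i).
Proof. by case: rV_sigma_algebra => _ _; apply. Qed.

HB.instance Definition _ := @isMeasurable.Build default_measure_display
  'rV[R]_n rV_measurable rV_measurable0 rV_measurableC rV_measurable_bigcup.

Lemma measurable_tuple_of_rV : measurable_fun [set: 'rV[R]_n] tuple_of_rV.
Proof. by move=> _ A mA; exists A. Qed.

Lemma measurable_rV_of_tuple :
  measurable_fun [set: n.-tuple (RT R)] rV_of_tuple.
Proof.
move=> _ _ [A mA <-]; rewrite !setTI -comp_preimage.
rewrite (_ : _ \o _ = id) ?preimage_id//.
by apply/funext => t /=; rewrite rV_of_tupleK.
Qed.

End rV_measurable.

HB.instance Definition _ (R : realType) (n : nat) :=
  isMeasurableFun.Build _ _ _ _ (@tuple_of_rV R n) measurable_tuple_of_rV.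
HB.instance Definition _ (R : realType) (n : nat) :=
  isMeasurableFun.Build _ _ _ _ (@rV_of_tuple R n) measurable_rV_of_tuple.

Section iso_measure.
Context d1 d2 (T1 : measurableType d1) (T2 : measurableType d2) (R : realType).
Variables (mu : {sigma_finite_measure set T1 -> \bar R}).
Variables (f : {mfun T1 >-> T2}) (g : {mfun T2 >-> T1}) (fK : cancel f g).

(* The inverse g is only used to see that the image measure is sigma-finite. *)
Definition iso_measure of cancel f g := pushforward mu f.

Let iso_measure0 : iso_measure fK set0 = 0%E.
Proof. exact: measure0. Qed.

Let iso_measure_ge0 A : (0 <= iso_measure fK A)%E.
Proof. exact: measure_ge0. Qed.

Let iso_measure_sigma_additive : semi_sigma_additive (iso_measure fK).
Proof. exact: measure_semi_sigma_additive. Qed.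

HB.instance Definition _ := isMeasure.Build _ _ _ (iso_measure fK)
  iso_measure0 iso_measure_ge0 iso_measure_sigma_additive.

Let iso_measure_sigma_finite : sigma_finite setT (iso_measure fK).
Proof.
have [A TA mA] := sigma_finiteT mu.
exists (fun i => g @^-1` A i) => [|i]; first by rewrite -preimage_bigcup -TA.
have [mAi Aioo] := mA i; split; first exact: measurable_funPTI.
rewrite /iso_measure /pushforward -comp_preimage.
by rewrite (_ : _ \o _ = id) ?preimage_id//; apply/funext => t /=; rewrite fK.
Qed.

HB.instance Definition _ := Measure_isSigmaFinite.Build _ _ _ (iso_measure fK)
  iso_measure_sigma_finite.

End iso_measure.

(* An alias of the library's product measure, for which no structure of
   sigma-finite measure can be inferred. *)
Section sigma_finite_product.
Context d1 d2 (T1 : measurableType d1) (T2 : measurableType d2) (R : realType).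
Variable m1 : {sigma_finite_measure set T1 -> \bar R}.
Variable m2 : {sigma_finite_measure set T2 -> \bar R}.

Definition sigma_finite_product := product_measure1 m1 m2.

HB.instance Definition _ := Measure.on sigma_finite_product.

Let sigma_finite_productT : sigma_finite setT sigma_finite_product.
Proof.
have /sigma_finiteP[F [TF ndF Foo]] := sigma_finiteT m1.
have /sigma_finiteP[G [TG ndG Goo]] := sigma_finiteT m2.
exists (fun n => F n `*` G n) => [|k].
  rewrite -setXTT TF TG predeqE => -[x y]; split=> [[/= [n _ Fn] [k _ Gk]]|].
    exists (maxn n k) => //; split.
      by move: x Fn; exact/subsetPset/ndF/leq_maxl.
    by move: y Gk; exact/subsetPset/ndG/leq_maxr.
  by move=> [n _ []/= ? ?]; split; exists n.
have [? ?] := Foo k; have [? ?] := Goo k; split; first exact: measurableX.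
by rewrite [ltLHS]product_measure1E// lte_mul_pinfty// ge0_fin_numE.
Qed.

HB.instance Definition _ := Measure_isSigmaFinite.Build _ _ _
  sigma_finite_product sigma_finite_productT.

End sigma_finite_product.

Section tuple_cons.
Context {R : realType} {n : nat}.

Definition tuple_cons (p : RT R * n.-tuple (RT R)) : n.+1.-tuple (RT R) :=
  [tuple of p.1 :: p.2].
Definition tuple_uncons (t : n.+1.-tuple (RT R)) : RT R * n.-tuple (RT R) :=
  (thead t, [tuple of behead t]).

Lemma tuple_consK : cancel tuple_cons tuple_uncons.
Proof. by move=> [x t]; congr pair; apply/val_inj. Qed.

Lemma measurable_tuple_cons : measurable_fun setT tuple_cons.
Proof. exact: measurable_cons. Qed.

Lemma measurable_tuple_uncons : measurable_fun setT tuple_uncons.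
Proof.
by apply: measurable_fun_pair; [exact: measurable_tnth|exact: measurable_behead].
Qed.

HB.instance Definition _ :=
  isMeasurableFun.Build _ _ _ _ tuple_cons measurable_tuple_cons.
HB.instance Definition _ :=
  isMeasurableFun.Build _ _ _ _ tuple_uncons measurable_tuple_uncons.

End tuple_cons.

Fixpoint lebesgue_tuple (R : realType) (n : nat) :
    {sigma_finite_measure set (n.-tuple (RT R)) -> \bar R} :=
  match n with
  | 0 => \d_([tuple] : 0.-tuple (RT R))
  | m.+1 => iso_measure
      (sigma_finite_product (@lebesgue_measure R) (lebesgue_tuple R m))
      (@tuple_consK R m)
  end.

Definition lebesgue_rV (R : realType) (n : nat) :
    {sigma_finite_measure set 'rV[R]_n -> \bar R} :=
  iso_measure (lebesgue_tuple R n) (@rV_of_tupleK R n).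

Section lebesgue_box.
Context {R : realType}.

Let box_cons n (A : 'I_n.+1 -> set (RT R)) (x : RT R) (t : n.-tuple (RT R)) :
  (forall i, A i (tnth (tuple_cons (x, t)) i)) <->
  A ord0 x /\ forall i, A (lift ord0 i) (tnth t i).
Proof.
split=> [h|[h0 h] i].
  by split=> [|i]; [exact: (h ord0)|have := h (lift ord0 i); rewrite tnthS].
by case: (unliftP ord0 i) => [j ->|->]; rewrite ?tnthS ?tnth0.
Qed.

Let measurable_box n (A : 'I_n -> set (RT R)) :
  (forall i, measurable (A i)) ->
  measurable [set t : n.-tuple (RT R) | forall i, A i (tnth t i)].
Proof.
move=> mA; rewrite (_ : [set t | _] = \bigcap_(i in [set: 'I_n])
    ((fun t : n.-tuple (RT R) => tnth t i) @^-1` A i)).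
  apply: fin_bigcap_measurable => // i _.
  by rewrite -[X in measurable X]setTI; exact: measurable_tnth.
by apply/seteqP; split=> t h; [move=> i _; exact: h|move=> i; exact: (h i I)].
Qed.

Lemma lebesgue_tuple_box n (A : 'I_n -> set (RT R)) :
  (forall i, measurable (A i)) ->
  lebesgue_tuple R n [set t | forall i, A i (tnth t i)] =
  (\prod_(i < n) lebesgue_measure (A i))%E.
Proof.
elim: n A => [|n IH] A mA.
  by rewrite big_ord0 [LHS]/= diracE mem_set// => i; have := ltn_ord i.
rewrite big_ord_recl -IH // [LHS]/= /iso_measure /pushforward.
rewrite (_ : _ @^-1` _ =
    A ord0 `*` [set t | forall i, A (lift ord0 i) (tnth t i)]).
  exact: (product_measure1E (@lebesgue_measure R) (lebesgue_tuple R n)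
    (mA ord0) (measurable_box (fun i => mA (lift ord0 i)))).
by apply/seteqP; split=> -[x t] /= /box_cons.
Qed.

Lemma lebesgue_rV_box n (A : 'I_n -> set (RT R)) :
  (forall i, measurable (A i)) ->
  lebesgue_rV R n [set x | forall i, A i (x ord0 i)] =
  (\prod_(i < n) lebesgue_measure (A i))%E.
Proof.
move=> mA; rewrite -lebesgue_tuple_box // /lebesgue_rV /= /iso_measure.
rewrite /pushforward; congr (lebesgue_tuple _ _ _).
by apply/seteqP; split=> t /= h i; have := h i; rewrite mxE.
Qed.

End lebesgue_box.

Section sobolev.
Context {R : realType} {n : nat}.
Implicit Types (Omega K : set 'rV[R]_n) (u g phi : 'rV[R]_n -> R) (i : 'I_n).

Local Notation mu := (lebesgue_rV R n).

(* Measurability is Borel measurability, which loses nothing up to equality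
   almost everywhere. *)
Definition locally_Lp Omega (p : R) u :=
  measurable_fun Omega u /\
  forall K, compact K -> K `<=` Omega ->
    (\int[mu]_(x in K) (`|u x| `^ p)%:E < +oo)%E.

Definition partial i u : 'rV[R]_n -> R :=
  fun x => 'D_(delta_mx ord0 i) (u : 'rV[R]_n -> R^o) x.

(* C^oo: every iterated partial derivative is Frechet differentiable. *)
Definition smooth u := forall (s : seq 'I_n) (x : 'rV[R]_n),
  differentiable (foldr partial u s : 'rV[R]_n -> R^o) x.

Definition test_function Omega phi :=
  let supp := closure [set x | phi x != 0] in
  [/\ smooth phi, compact supp & supp `<=` Omega].

Definition weak_partial Omega i u g :=
  [/\ locally_Lp Omega 1 u, locally_Lp Omega 1 g &
    forall phi, test_function Omega phi ->
      \int[mu]_(x in Omega) (u x * partial i phi x) =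
      - \int[mu]_(x in Omega) (g x * phi x)].

Definition sobolev_loc Omega (p : R) u :=
  locally_Lp Omega p u /\
  forall i, exists g, locally_Lp Omega p g /\ weak_partial Omega i u g.

Definition sobolev_map_loc (m : nat) Omega (p : R) (h : 'rV[R]_n -> 'rV[R]_m) :=
  forall j : 'I_m, sobolev_loc Omega p (fun x => h x ord0 j).

End sobolev.

Section biconformal.
Context {R : realType} {n : nat}.
Implicit Types (X Y : set 'rV[R]_n) (h f : 'rV[R]_n -> 'rV[R]_n).

(* Maps between subsets of R^n are total functions, whose values outside the
   given domain are irrelevant. *)
Definition homeomorphism X Y h f :=
  [/\ {within X, continuous h}, {within Y, continuous f},
    forall x, X x -> Y (h x) /\ f (h x) = x &
    forall y, Y y -> X (f y) /\ h (f y) = y].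

(* h : X -> Y is a deformation of bi-conformal energy, with inverse f. *)
Definition biconformal_deformation X Y h f :=
  [/\ homeomorphism X Y h f,
    sobolev_map_loc X n%:R h & sobolev_map_loc Y n%:R f].

Definition is_maximum (A : set R) (m : R) := A m /\ ubound A m.

(* The default value of get is never used when h is continuous, s >= 0 and
   n > 0, since the sphere is then compact and nonempty. *)
Definition optimal_modulus h (x0 : 'rV[R]_n) (s : R) : R :=
  [get m | is_maximum
    [set enorm (h x - h x0) | x in [set x | enorm (x - x0) = s]] m].

End biconformal.

(* The values at s < 0 are irrelevant. *)
Definition phi_modulus (R : realType) (n : nat) (s : R) : R :=
  if s <= 0 then 0
  else if s <= 1 then
    ln (expR 1 / s) `^ (- n%:R^-1) * (ln (ln (expR (expR 1) / s)))^-1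
  else s.

(* Main.v *)
(** Both maps are angle-dependent radial stretchings.  For a latitude
    [0 <= l <= 1] let [g_l r = (1 - l) r + l phi r], let [g_l] for [- 1 <= l <= 0]
    be the inverse of [g_(- l)], and let [H] send the point at distance [r] from
    the origin in the direction [t] to [g_l r] in the same direction, where [l] is
    a fixed coordinate of [t].  The map [F] is obtained from the opposite
    coordinate.  At the north pole [H] is the radial stretching by [phi], at the
    south pole it is its inverse, and [F] exchanges the two.

    Since [phi] is increasing with slope bounded below and [phi r / r] is
    nonincreasing, [|H x - H y| <= C (phi |x| / |x|) |x - y|], and likewise for
    [F].  This bound gives the modulus of continuity, and it gives the Sobolev
    regularity: [phi |x| / |x|] is locally in [L^n] because
    [\int_0 phi(r)^n dr / r < oo], and on almost every line parallel to an axis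
    the map is Lipschitz, hence almost everywhere differentiable, so that the
    difference quotients converge almost everywhere and dominatedly. *)

From HB Require Import structures.
Require Import Defs.
From mathcomp Require Import all_boot all_order all_algebra.
From mathcomp Require Import ring lra.
From mathcomp Require Import all_classical all_reals all_analysis.
From mathcomp Require Import measurable_realfun.

Import Order.TTheory GRing.Theory Num.Theory.
Import numFieldNormedType.Exports.

Set Implicit Arguments.
Unset Strict Implicit.
Unset Printing Implicit Defensive.

Local Open Scope classical_set_scope.
Local Open Scope ring_scope.

(** * Almost everywhere differentiability of Lipschitz functions of one variable *)

Section lipschitz_derivable.
Context {R : realType}.
Notation mu := (@lebesgue_measure R).

(** A radial stretching by [phi] alone would fail: its inverse has at the origin the modulus inverse
    to [phi], which is at most [s]. Both behaviours must occur in one map, in different directions.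
    Since rays are preserved, so are latitudes, and inversion reduces to exchanging [l] and [- l] on
    each ray. Passing between the directions is cheap: changing [l] moves [g_l r] by at most a
    constant times [phi r] per unit, and the latitude varies at rate [1 / r], so the cost is of
    order [phi r / r], which the stretching by [phi] has anyway in the tangential directions. The
    lower slope bound of [phi] makes the inverse branches Lipschitz in [r]. With [r = exp (- t)] the
    energy integral becomes that of [1 / ((1 + t) ln (e + t) ^ n)]: the power [- 1 / n] of the
    logarithm alone would give divergence, and the iterated logarithm gives convergence because
    [n >= 2]. The Lipschitz bound degenerates at the origin, so a line through it is out of control;
    for [n >= 2] the one such line parallel to a given axis is null. *)

Definition mono_cumulative (G : R -> R) (nd : nondecreasing G)
    (cG : continuous G) : cumulative R R :=
  HB.pack G (isCumulative.Build R _ R G nd (right_continuousW cG)).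

Lemma stieltjes_itv (G : R -> R) (nd : nondecreasing G) (cG : continuous G) (a b : R) : a <= b ->
  lebesgue_stieltjes_measure (mono_cumulative nd cG) `]a, b] = (G b - G a)%:E.
Proof.
move=> ab; rewrite /lebesgue_stieltjes_measure /measure_extension.
rewrite measurable_mu_extE/=; last exact: is_ocitv.
by rewrite wlength_itv_bnd// ge0_cp.
Qed.

Lemma lipschitz_continuous (f : R -> R) (L : R) :
  (forall x y, `|f x - f y| <= L * `|x - y|) -> continuous f.
Proof.
move=> fL x; apply/cvgrPdist_le => e e0; near=> y.
rewrite (le_trans (fL _ _))//.
apply: (@le_trans _ _ ((`|L| + 1) * `|x - y|)).
  by rewrite ler_wpM2r// (le_trans (ler_norm _))// lerDl.
rewrite mulrC -ler_pdivlMr; last by rewrite ltr_wpDl.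
near: y; apply: cvgr_dist_le; first exact: cvg_id.
by rewrite divr_gt0// ltr_wpDl.
Unshelve. all: by end_near. Qed.

(** * Monotone functions whose Stieltjes measure is absolutely continuous *)

Section dominated.
Variables (G G' : R -> R) (L : R).
Hypotheses (ndG : nondecreasing G) (cG : continuous G).
Hypotheses (ndG' : nondecreasing G') (cG' : continuous G').
Hypotheses (L0 : 0 < L) (GG' : forall x, G x + G' x = L * x).
Let nu := lebesgue_stieltjes_measure (mono_cumulative ndG cG).
Let nu' := lebesgue_stieltjes_measure (mono_cumulative ndG' cG').

(* By uniqueness, the Stieltjes measures of [G] and [G'] add up to [L] times
   the Lebesgue measure. *)
Lemma stieltjes_dominated : nu `<< mu.
Proof.
have Li0 : 0 <= L^-1 by rewrite invr_ge0 ltW.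
pose m := mscale (NngNum Li0) (measure_add nu nu').
have mE A : (L^-1%:E * (nu A + nu' A))%E = m A.
  by rewrite /m [RHS]/mscale/= -measure_addE.
have E A : measurable A -> mu A = (L^-1%:E * (nu A + nu' A))%E.
  move=> mA; rewrite mE.
  apply: lebesgue_measure_unique => // X [[a b] _ <-]; apply: etrans (mE _); rewrite /=.
  case: (leP a b) => ab; last first.
    by rewrite /nu /nu' set_itv_ge ?measure0 ?adde0 ?mule0//= bnd_simp -leNgt ltW.
  rewrite /nu /nu' !stieltjes_itv//= -EFinD -EFinM.
  rewrite lebesgue_measure_itv/= lte_fin.
  have -> : G b - G a + (G' b - G' a) = L * (b - a).
    by rewrite mulrBr -!GG'; lra.
  rewrite mulKf ?gt_eqF//; case: ltP => [_|ba]; first by rewrite EFinB.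
  have -> : a = b by apply/le_anti; rewrite ab.
  by rewrite subrr.
move=> A nA B mB BA; have := nA _ mB BA; rewrite E// => /eqP.
rewrite mule_eq0 => /orP[|].
  by rewrite eqe invr_eq0 gt_eqF.
by rewrite padde_eq0 ?measure_ge0// => /andP[/eqP].
Qed.

(** On []a, b]] the Stieltjes measure is finite and absolutely continuous, so [G - G a] is the
    integral of its Radon-Nikodym density, and the fundamental theorem of calculus for integrable
    functions applies. *)
Lemma stieltjes_ae_derivable (a b : R) :
  {ae mu, forall x, a < x < b -> derivable G x 1}.
Proof.
have [ab|ba] := ltP a b; last first.
  by apply: aeW => x /andP[ax xb]; have := lt_trans ax xb; rewrite ltNge ba.
have mD : measurable (`]a, b] : set (measurableTypeR R)) by exact: measurable_itv.
have Doo : (nu `]a, b]%classic < +oo)%E by rewrite /nu stieltjes_itv ?ltW// ltry.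
pose nD : {charge set (measurableTypeR R) -> \bar R} := charge_of_finite_measure (mfrestr mD Doo).
have dom : nD `<< mu.
  move=> A nA B mB BA; rewrite /nD /= /mfrestr /mrestr.
  apply: stieltjes_dominated; [exact: nA| |].
    exact: measurableI.
  by apply: subset_trans BA; exact: subIsetl.
pose g := fine \o Radon_Nikodym nD mu.
have ig : mu.-integrable setT (EFin \o g).
  have -> : EFin \o g = Radon_Nikodym nD mu.
    by apply/funext => x; rewrite /= fineK//; exact: Radon_Nikodym_fin_num.
  exact: Radon_Nikodym_integrable.
have nE A : measurable A -> nD A = (\int[mu]_(x in A) (g x)%:E)%E.
  move=> mA; rewrite (Radon_Nikodym_integral dom mA).
  by apply: eq_integral => x _; rewrite /g/= fineK//; exact: Radon_Nikodym_fin_num.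
have igy (y : R) : mu.-integrable [set` Interval (BRight a) (BRight y)] (EFin \o g).
  by apply: (integrableS measurableT).
have := @FTC1 R g (BRight a) igy (open_integrable_locally openT ig).
apply: filterS; first exact: (ae_filter_ringOfSetsType mu).
move=> x + /andP[ax xb] => /(_ ax)[+ _].
set F := (F in derivable F _ _) => dF.
(* Derivability is local: it suffices that the primitive equals [G - G a] on []a, b[], where the
   restricted measure of []a, y]] is [G y - G a]. *)
have -> : G = (fun y => G y - G a) + cst (G a).
  by apply/funext => y; rewrite fctE /= subrK.
apply: derivableD; last exact: derivable_cst.
apply: near_eq_derivable dF.
have xab : x \in `]a, b[ by rewrite in_itv/= ax.
apply: filterS (near_in_itvoo xab) => y; rewrite /= in_itv/= => /andP[ay yb].
rewrite /F /Rintegral.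
have mX : measurable (`]a, y] : set (measurableTypeR R)) by exact: measurable_itv.
rewrite -(nE _ mX) /nD/= /mfrestr /mrestr /=.
rewrite setIidl; first by rewrite /nu stieltjes_itv// ltW.
by apply: subset_itvl; rewrite bnd_simp ltW.
Qed.
End dominated.

(* [M x + f x] and [M x - f x] are nondecreasing with sum [2 M x]. *)
Lemma lipschitz_ae_derivable (f : R -> R) (L : R) :
  (forall x y, `|f x - f y| <= L * `|x - y|) ->
  {ae mu, forall x, derivable f x 1}.
Proof.
move=> fL.
pose M := `|L| + 1.
have M0 : 0 < M by rewrite ltr_wpDl.
have fM x y : `|f x - f y| <= M * `|x - y|.
  by rewrite (le_trans (fL _ _))// ler_wpM2r// (le_trans (ler_norm _))// lerDl.
have cf := lipschitz_continuous fL.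
have cM : continuous (fun x => M * x).
  by move=> x; apply: cvgM; [exact: cvg_cst|exact: cvg_id].
pose G x := M * x + f x; pose G' x := M * x - f x.
have cG : continuous G by move=> x; apply: cvgD; [exact: cM|exact: cf].
have cG' : continuous G' by move=> x; apply: cvgB; [exact: cM|exact: cf].
have ndG : nondecreasing G.
  move=> x y xy; rewrite /G; have := fM x y.
  by rewrite ler_norml (ler0_norm (_ : x - y <= 0)) ?subr_le0//; nra.
have ndG' : nondecreasing G'.
  move=> x y xy; rewrite /G'; have := fM x y.
  by rewrite ler_norml (ler0_norm (_ : x - y <= 0)) ?subr_le0//; nra.
have L0 : 0 < 2 * M by rewrite mulr_gt0.
have GG' x : G x + G' x = 2 * M * x by rewrite /G /G'; ring.
have aeG := stieltjes_ae_derivable ndG cG ndG' cG' L0 GG'.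
suff : {ae mu, forall x, derivable G x 1}.
  apply: filterS; first exact: (ae_filter_ringOfSetsType mu).
move=> x dG.
  have -> : f = G - (fun x => M * x).
    by apply/funext => y; rewrite /G !fctE addrC addKr.
  by apply: derivableB => //; exact: derivableM.
have : {ae mu, forall x (k : nat), - k%:R < x < k%:R -> derivable G x 1}.
  by apply/ae_foralln => k; exact: aeG.
apply: filterS; first exact: (ae_filter_ringOfSetsType mu).
move=> x /(_ (Num.bound `|x|)); apply.
by rewrite -ltr_norml archi_boundP.
Qed.
End lipschitz_derivable.

(** * Lebesgue measure on [R^n] *)

Section measurable_rV.
Context {R : realType} {n : nat}.

Lemma measurable_coord (i : 'I_n) : measurable_fun setT (fun x : 'rV[R]_n => x ord0 i).
Proof.
have -> : (fun x : 'rV[R]_n => x ord0 i) = (fun t => tnth t i) \o tuple_of_rV.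
  by apply/funext => x /=; rewrite tnth_mktuple.
apply: measurableT_comp; [exact: measurable_tnth|exact: measurable_tuple_of_rV].
Qed.

Lemma measurable_rV_of_coord d (T : measurableType d) (f : T -> 'rV[R]_n) :
  (forall i, measurable_fun setT (fun t => f t ord0 i)) -> measurable_fun setT f.
Proof.
move=> mf.
have -> : f = @rV_of_tuple R n \o (@tuple_of_rV R n \o f).
  by apply/funext => t /=; rewrite tuple_of_rVK.
apply: measurableT_comp; first exact: measurable_rV_of_tuple.
apply/measurable_fun_tnthP => i.
apply: eq_measurable_fun (mf i) => t _ /=.
by rewrite tnth_mktuple.
Qed.

Lemma measurable_rV_box (A : 'I_n -> set R) :
  (forall i, measurable (A i)) -> measurable [set x : 'rV[R]_n | forall i, A i (x ord0 i)].
Proof.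
move=> mA; rewrite (_ : [set x | _] = \bigcap_(i in [set: 'I_n])
    ((fun x : 'rV[R]_n => x ord0 i) @^-1` A i)).
  apply: fin_bigcap_measurable => // i _.
  by rewrite -[X in measurable X]setTI; exact: measurable_coord.
by apply/seteqP; split=> t h; [move=> i _; exact: h|move=> i; exact: (h i I)].
Qed.

(** The sigma-algebra is generated by the coordinates, so an open set is exhibited as a countable
    union of boxes with rational centres and radii [1 / (k + 1)]. *)
Lemma open_measurable_rV (U : set 'rV[R]_n) : open U -> measurable U.
Proof.
move=> oU.
pose bx (q : 'rV[rat]_n * nat) : set 'rV[R]_n :=
  [set x | forall i, `|x ord0 i - ratr (q.1 ord0 i)| < q.2.+1%:R^-1].
rewrite (_ : U = \bigcup_(q in [set q | bx q `<=` U]) bx q).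
  rewrite bigcup_mkcond; apply: countable_bigcupT_measurable => [|q].
    exact: countableP.
  case: ifPn => // _.
  apply: (@measurable_rV_box (fun i => [set y | `|y - ratr (q.1 ord0 i)| < q.2.+1%:R^-1])).
  move=> i.
  have -> : [set y : R | `|y - ratr (q.1 ord0 i)| < q.2.+1%:R^-1] =
      ball (ratr (q.1 ord0 i) : R) q.2.+1%:R^-1.
    by apply/seteqP; split => y; rewrite /ball/= distrC.
  by rewrite ball_itv; exact: measurable_itv.
apply/seteqP; split=> [x Ux|x [q qU]]; last exact: qU.
have /nbhs_ballP[e /= e0 eU] : nbhs x U by move: oU; rewrite openE => /(_ _ Ux).
(* Two radii must fit into [e]: one from [x] to the rational centre, one from the centre to [y]. *)
pose k := (Num.truncn (2 / e)).
have k0 : 0 < k.+1%:R^-1 :> R by rewrite invr_gt0.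
have ke : k.+1%:R^-1 + k.+1%:R^-1 < e.
  rewrite -mulr2n -(mulr_natl (_^-1)) ltr_pdivrMr// mulrC -ltr_pdivrMr//.
  by rewrite truncnS_gt.
have /choice[q qE] (i : 'I_n) : exists q : rat, `|x ord0 i - ratr q| < k.+1%:R^-1.
  have [|q] := @rat_in_itvoo R (x ord0 i - k.+1%:R^-1) (x ord0 i + k.+1%:R^-1).
    by rewrite ltrBlDr -addrA ltrDl addr_gt0.
  by rewrite in_itv /= => qx; exists q; rewrite distrC ltr_distl.
exists (\row_i q i, k) => /=; last by move=> i; rewrite mxE.
move=> y yq; apply: eU; split=> // i0 i; rewrite ord1 /ball/=.
apply: le_lt_trans ke.
rewrite (le_trans (ler_distD (ratr (q i)) _ _))// lerD ?ltW//.
by have := yq i; rewrite mxE distrC.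
Qed.

Lemma continuous_measurable_rV (u : 'rV[R]_n -> R) : continuous u -> measurable_fun setT u.
Proof.
move=> /continuousP cu; apply: (measurability _ (measurable_realfun.RGenOpens.measurableE R)).
by move=> _ [_ [a [b ->] <-]]; rewrite setTI; apply: open_measurable_rV; exact/cu/interval_open.
Qed.
End measurable_rV.

Local Notation RT := measurableTypeR.

(** * Translation invariance and null sets along coordinate lines *)

Section translation.
Context {R : realType}.
Local Notation mu1 := (@lebesgue_measure R).

Lemma measurable_translation (c : R) : measurable_fun setT ((fun x => x + c) : RT R -> RT R).
Proof. by apply: measurable_funD; [exact: measurable_id|exact: measurable_cst]. Qed.

Lemma lebesgue_translation (c : R) (A : set (RT R)) : measurable A ->
  mu1 ((fun x => x + c) @^-1` A) = mu1 A.
Proof.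
move=> mA.
apply/esym.
have := @lebesgue_measure_unique R (pushforward mu1 ((fun x => x + c) : RT R -> RT R)).
move/(_ (measurable_translation c) _ A mA); apply => X [[a b] _ <-]/=.
rewrite /pushforward.
rewrite (_ : _ @^-1` _ = `]a - c, b - c]%classic); last first.
  by apply/seteqP; split => x /=; rewrite !in_itv/= ltrBlDr lerBrDr.
rewrite !lebesgue_measure_itv/= !lte_fin ltrD2r; case: ifP => // _.
by rewrite -!EFinB; congr EFin; lra.
Qed.

Definition tuple_add n (v t : n.-tuple (RT R)) : n.-tuple (RT R) :=
  [tuple tnth t i + tnth v i | i < n].

Lemma measurable_tuple_add n (v : n.-tuple (RT R)) : measurable_fun setT (tuple_add v).
Proof.
apply/measurable_fun_tnthP => i.
apply: (eq_measurable_fun ((fun x => x + tnth v i) \o (fun t => tnth t i))).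
  by move=> t _ /=; rewrite tnth_mktuple.
by apply: measurableT_comp; [exact: measurable_translation|exact: measurable_tnth].
Qed.

Lemma tuple_add_cons n (x y : RT R) (v t : n.-tuple (RT R)) :
  tuple_add (tuple_cons (y, v)) (tuple_cons (x, t)) = tuple_cons (x + y, tuple_add v t).
Proof.
apply: eq_from_tnth => i; rewrite tnth_mktuple.
by case: (unliftP ord0 i) => [j ->|->]; rewrite ?tnthS ?tnth0// tnth_mktuple.
Qed.

(** [tuple_cons] turns the translation into a product of translations of head and tail, and the
    product measure is determined by its values on rectangles. *)
Lemma lebesgue_tuple_translation n (v : n.-tuple (RT R)) A : measurable A ->
  lebesgue_tuple R n (tuple_add v @^-1` A) = lebesgue_tuple R n A.
Proof.
elim: n v A => [|n IH] v A mA.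
  have -> : tuple_add v @^-1` A = A.
    by apply/seteqP; split => t /=; rewrite (tuple0 t) (tuple0 (tuple_add _ _)).
  by [].
have [y [w ->]] : exists y w, v = tuple_cons (y, w).
  by case/tupleP: v => y w; exists y, w; exact: val_inj.
rewrite /= /iso_measure /pushforward.
set B := @tuple_cons R n @^-1` A.
have mB : measurable B by rewrite -[B]setTI; exact: measurable_tuple_cons.
have -> : @tuple_cons R n @^-1` (tuple_add (tuple_cons (y, w)) @^-1` A) =
    (fun p : RT R * n.-tuple (RT R) => (p.1 + y, tuple_add w p.2)) @^-1` B.
  by apply/seteqP; split => -[x t] /=; rewrite /B/= tuple_add_cons.
have mf : measurable_fun setT (fun p : RT R * n.-tuple (RT R) =>
    ((p.1 + y, tuple_add w p.2) : RT R * n.-tuple (RT R))).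
  apply: measurable_fun_pair.
    exact: (measurableT_comp (measurable_translation y) measurable_fst).
  exact: (measurableT_comp (measurable_tuple_add w) measurable_snd).
apply/esym.
have := @product_measure_unique _ _ _ _ R mu1 (lebesgue_tuple R n)
  (pushforward (sigma_finite_product mu1 (lebesgue_tuple R n))
    (fun p : RT R * n.-tuple (RT R) => ((p.1 + y, tuple_add w p.2) : RT R * n.-tuple (RT R)))).
move/(_ mf _ B mB); apply.
move=> A1 A2 mA1 mA2; rewrite /= /pushforward.
rewrite [X in sigma_finite_product _ _ X](_ : _ =
  ((fun x => x + y) @^-1` A1) `*` (tuple_add w @^-1` A2))//.
rewrite /sigma_finite_product product_measure1E.
- by congr (_ * _)%E; [exact: lebesgue_translation|exact: IH].
- by rewrite -[X in measurable X]setTI; exact: measurable_translation.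
- by rewrite -[X in measurable X]setTI; exact: measurable_tuple_add.
Qed.

(** Tonelli along one coordinate. If [i] lies in the tail, the sections at a fixed head are null by
    induction; if it is the head, the order of integration is reversed so that the inner integral
    runs over the head. *)
Lemma lebesgue_tuple_line_null n (i : 'I_n) (A : set (n.-tuple (RT R))) : measurable A ->
  (forall t, mu1 [set s | A [tuple if j == i then s else tnth t j | j < n]] = 0%E) ->
  lebesgue_tuple R n A = 0%E.
Proof.
elim: n i A => [|n IH] i A mA A0; first by case: i A0.
rewrite /= /iso_measure /pushforward.
set B := @tuple_cons R n @^-1` A.
have mB : measurable B by rewrite -[B]setTI; exact: measurable_tuple_cons.
case: (unliftP ord0 i) A0 => [k ->|->] A0.
  rewrite /sigma_finite_product /product_measure1.
  apply: integral0_eq => x _ /=; apply: (IH k).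
    exact: measurable_xsection.
  move=> t; rewrite -[RHS](A0 (tuple_cons (x, t))); congr (mu1 _).
  have E s : tuple_cons (x, [tuple if j == k then s else tnth t j | j < n]) =
      [tuple if j == lift ord0 k then s else tnth (tuple_cons (x, t)) j | j < n.+1].
    apply: eq_from_tnth => j; rewrite [RHS]tnth_mktuple.
    by case: (unliftP ord0 j) => [l ->|->]; rewrite ?tnthS ?tnth0 ?tnth_mktuple ?(inj_eq lift_inj).
  by apply/seteqP; split => s /=; rewrite -E /xsection/= inE.
have -> : sigma_finite_product mu1 (lebesgue_tuple R n) B =
    product_measure2 mu1 (lebesgue_tuple R n) B.
  apply: product_measure_unique => // A1 A2 mA1 mA2; exact: product_measure2E.
rewrite /product_measure2.
apply: integral0_eq => t _ /=.
rewrite -[RHS](A0 (tuple_cons (0, t))); congr (mu1 _).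
have E s : tuple_cons (s, t) =
      [tuple if j == ord0 then s else tnth (tuple_cons (0, t)) j | j < n.+1].
    apply: eq_from_tnth => j; rewrite [RHS]tnth_mktuple.
    by case: (unliftP ord0 j) => [l ->|->]; rewrite ?tnthS ?tnth0 .
by apply/seteqP; split => s /=; rewrite -E /ysection/= inE.
Qed.
End translation.

Section lebesgue_rV.
Context {R : realType} {n : nat}.
Local Notation mu1 := (@lebesgue_measure R).
Local Notation mu := (lebesgue_rV R n).

Lemma measurable_add_rV (v : 'rV[R]_n) : measurable_fun setT (fun x : 'rV[R]_n => x + v).
Proof.
apply: measurable_rV_of_coord => i.
have -> : (fun t : 'rV[R]_n => (t + v) ord0 i) = (fun t => t ord0 i + v ord0 i).
  by apply/funext => t; rewrite mxE.
by apply: measurable_funD => //; exact: measurable_coord.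
Qed.

Lemma lebesgue_rV_translation (v : 'rV[R]_n) A : measurable A ->
  mu ((fun x => x + v) @^-1` A) = mu A.
Proof.
move=> mA; rewrite /lebesgue_rV /= /iso_measure /pushforward.
rewrite -[RHS](lebesgue_tuple_translation (tuple_of_rV v)); last first.
  by rewrite -[X in measurable X]setTI; exact: measurable_rV_of_tuple.
congr (lebesgue_tuple _ _ _); apply/seteqP; split => t /=.
  rewrite (_ : rV_of_tuple (tuple_add _ _) = rV_of_tuple t + v)//.
  by apply/rowP => i; rewrite !mxE !tnth_mktuple.
rewrite (_ : rV_of_tuple (tuple_add _ _) = rV_of_tuple t + v)//.
by apply/rowP => i; rewrite !mxE !tnth_mktuple.
Qed.

Lemma ge0_integral_translation (v : 'rV[R]_n) (f : 'rV[R]_n -> \bar R) :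
  measurable_fun setT f -> (forall x, 0 <= f x)%E ->
  (\int[mu]_x f (x + v)%R = \int[mu]_x f x)%E.
Proof.
move=> mf f0.
have := @ge0_integral_pushforward _ _ _ _ _ _ (measurable_add_rV v) mu setT f
  measurableT mf (fun x _ => f0 x).
rewrite preimage_setT => <-.
apply: eq_measure_integral; first exact: measurable_add_rV.
by move=> ? A mA _; exact: (lebesgue_rV_translation v mA).
Qed.

Lemma integrable_translation (v : 'rV[R]_n) (f : 'rV[R]_n -> \bar R) :
  mu.-integrable setT f -> mu.-integrable setT (fun x => f (x + v)).
Proof.
move=> /integrableP[mf fy]; apply/integrableP; split.
  by apply: (measurableT_comp mf); exact: measurable_add_rV.
by rewrite (@ge0_integral_translation v (fun x => `|f x|%E))//; exact: measurableT_comp.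
Qed.

Lemma integral_translation (v : 'rV[R]_n) (f : 'rV[R]_n -> \bar R) :
  mu.-integrable setT f -> (\int[mu]_x f (x + v)%R = \int[mu]_x f x)%E.
Proof.
move=> intf; have /integrableP[mf _] := intf.
rewrite integralE [RHS]integralE.
have Ep : ((fun x => f (x + v)%R)^\+ = fun x => (f^\+ (x + v)%R))%E by rewrite !unlock.
have En : ((fun x => f (x + v)%R)^\- = fun x => (f^\- (x + v)%R))%E by rewrite !unlock.
rewrite Ep En (ge0_integral_translation _ (measurable_funepos mf))//.
by rewrite (ge0_integral_translation _ (measurable_funeneg mf)).
Qed.

Lemma lebesgue_rV_line_null (i : 'I_n) (E : set 'rV[R]_n) : measurable E ->
  (forall x, mu1 [set s | E (x + s *: delta_mx ord0 i)] = 0%E) -> mu E = 0%E.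
Proof.
move=> mE E0; rewrite /lebesgue_rV /= /iso_measure /pushforward.
apply: (@lebesgue_tuple_line_null R n i).
  by rewrite -[X in measurable X]setTI; exact: measurable_rV_of_tuple.
(* Coordinate [i] of the base point is set to 0, so that the parameter [s] is that coordinate
   itself. *)
move=> t; rewrite -[RHS](E0 (rV_of_tuple [tuple if j == i then 0 else tnth t j | j < n])).
congr (mu1 _).
have Es s : rV_of_tuple [tuple if j == i then s else tnth t j | j < n] =
    rV_of_tuple [tuple if j == i then 0 else tnth t j | j < n] + s *: delta_mx ord0 i.
  apply/rowP => j; rewrite !mxE !tnth_mktuple eqxx /=.
  by case: eqVneq => /=; rewrite ?mulr1 ?mulr0 ?add0r ?addr0.
by apply/seteqP; split => s /=; rewrite -Es.
Qed.

Lemma measurable_hyperplane (j : 'I_n) : measurable [set x : 'rV[R]_n | x ord0 j = 0].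
Proof.
rewrite -[X in measurable X]setTI.
exact: (measurable_coord j measurableT (measurable_set1 0)).
Qed.

Lemma lebesgue_rV_hyperplane (j : 'I_n) : mu [set x | x ord0 j = 0] = 0%E.
Proof.
apply: (@lebesgue_rV_line_null j).
  exact: measurable_hyperplane.
move=> x; rewrite (_ : [set s | _] = [set - x ord0 j]) ?lebesgue_measure_set1//.
apply/seteqP; split => s /=; rewrite !mxE !eqxx mulr1.
  by move/eqP; rewrite addr_eq0 => /eqP ->; rewrite opprK.
by move=> ->; rewrite subrr.
Qed.

(** A line in direction [i] through the origin lies in a hyperplane [x_j = 0] with [j != i], which
    exists because [n >= 2] and is null. This removes the lines on which no uniform Lipschitz bound
    is available. *)
Lemma lebesgue_rV_line_null0 (i : 'I_n) (E : set 'rV[R]_n) : (2 <= n)%N -> measurable E ->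
  (forall x, (forall s, x + s *: delta_mx ord0 i != 0) ->
    mu1 [set s | E (x + s *: delta_mx ord0 i)] = 0%E) -> mu E = 0%E.
Proof.
move=> n2 mE E0.
have [j ji] : exists j : 'I_n, j != i.
  case: n n2 i {mE E0} => [|[|m]]// _ i.
  case: (eqVneq i ord0) => [->|i0]; last by exists ord0; rewrite eq_sym.
  by exists ord_max.
pose Z := [set x : 'rV[R]_n | x ord0 j = 0].
have mZ : measurable Z by exact: measurable_hyperplane.
apply/eqP; rewrite eq_le measure_ge0 andbT.
have -> : E = (E `\` Z) `|` (E `&` Z) by rewrite setUC setUIDK.
apply: (@le_trans _ _ (mu (E `\` Z) + mu (E `&` Z))%E).
  by apply: measureU2; [exact: measurableD|exact: measurableI].
have -> : mu (E `\` Z) = 0%E.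
  apply: (@lebesgue_rV_line_null i); first exact: measurableD.
  move=> x; have [xj|xj] := eqVneq (x ord0 j) 0.
    rewrite (_ : [set s | _] = set0) ?measure0//; apply/seteqP; split => // s [_ /=].
    by rewrite /Z /= !mxE /= (negbTE ji) /= mulr0 addr0.
  rewrite (_ : [set s | _] = [set s | E (x + s *: delta_mx ord0 i)]).
    apply: E0 => s; apply/negP => /eqP/rowP/(_ j); rewrite !mxE /= (negbTE ji) /= mulr0 addr0.
    exact/eqP.
  apply/seteqP; split => s /=; first by case.
  by move=> ?; split => //; rewrite /Z /= !mxE /= (negbTE ji) /= mulr0 addr0; exact/eqP.
rewrite add0e -(lebesgue_rV_hyperplane j); apply: le_measure; rewrite ?inE//.
exact: measurableI.
Qed.
End lebesgue_rV.

(** * Local integrability *)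

Section compact_rV.
Context {R : realType} {n : nat}.
Local Notation mu := (lebesgue_rV R n).
Implicit Types (K : set 'rV[R]_n) (u : 'rV[R]_n -> R).

Lemma compact_measurable_rV K : compact K -> measurable K.
Proof.
move=> cK; rewrite -[K]setCK; apply: measurableC; apply: open_measurable_rV.
by apply: closed_openC; apply: compact_closed => //; exact: norm_hausdorff.
Qed.

Lemma compact_subset_box K : compact K ->
  exists2 r : R, 0 < r & K `<=` [set x | forall i, `|x ord0 i| <= r].
Proof.
move=> /compact_bounded[M0 [_ M0K]].
exists (`|M0| + 1); first by rewrite ltr_wpDl.
move=> x Kx i; apply: le_trans (M0K _ _ _ Kx); last by rewrite (le_lt_trans (ler_norm _))// ltrDl.
rewrite [leRHS]mx_normrE.
exact: (le_bigmax_cond _ (fun ij : 'I_1 * 'I_n => `|x ij.1 ij.2|) (isT : xpredT (ord0, i))).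
Qed.

Lemma measurable_cube (r : R) : measurable [set x : 'rV[R]_n | forall i, `|x ord0 i| <= r].
Proof.
apply: (@measurable_rV_box R n (fun=> [set y | `|y| <= r])) => _.
rewrite (_ : [set y : R | _] = `[- r, r]%classic); first exact: measurable_itv.
by apply/seteqP; split => y /=; rewrite in_itv/= ler_norml.
Qed.

Lemma lebesgue_cube (r : R) : 0 <= r -> mu [set x | forall i, `|x ord0 i| <= r] = ((2 * r) ^+ n)%:E.
Proof.
move=> r0; rewrite (@lebesgue_rV_box R n (fun=> [set y | `|y| <= r])); last first.
  move=> _; rewrite (_ : [set y : R | _] = `[- r, r]%classic); first exact: measurable_itv.
  by apply/seteqP; split => y /=; rewrite in_itv/= ler_norml.
rewrite (eq_bigr (fun=> (2 * r)%:E)); last first.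
  move=> _ _; rewrite (_ : [set y : R | _] = `[- r, r]%classic); last first.
    by apply/seteqP; split => y /=; rewrite in_itv/= ler_norml.
  rewrite lebesgue_measure_itv/= lte_fin; case: ltP => r1.
    by rewrite -EFinB opprK mulr2n mulrDl mul1r.
  by have -> : r = 0 by [lra]; rewrite mulr0.
by rewrite prodEFin prodr_const card_ord.
Qed.

Lemma compact_lty K : compact K -> (mu K < +oo)%E.
Proof.
move=> cK; have [r r0 Kr] := compact_subset_box cK.
apply: le_lt_trans (le_measure _ _ _ Kr) _; rewrite ?inE.
- exact: compact_measurable_rV.
- exact: measurable_cube.
- by rewrite [ltLHS]lebesgue_cube ?ltry// ltW.
Qed.

Lemma continuous_compact_le K u : continuous u -> compact K ->
  exists2 B : R, 0 <= B & forall x, K x -> `|u x| <= B.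
Proof.
move=> cu cK; have : compact (u @` K).
  by apply: continuous_compact => //; exact: continuous_subspaceT.
move=> /compact_bounded[B0 [_ B0K]].
exists (`|B0| + 1); first by rewrite addr_ge0.
by move=> x Kx; apply: B0K; [rewrite (le_lt_trans (ler_norm _))// ltrDl|exists x].
Qed.

Lemma continuous_locally_Lp u (p : R) : 0 <= p -> continuous u -> locally_Lp setT p u.
Proof.
move=> p0 cu; split; first exact: continuous_measurable_rV.
move=> K cK _; have [B B0 uB] := continuous_compact_le cu cK.
have mK := compact_measurable_rV cK.
apply: (@le_lt_trans _ _ (\int[mu]_(x in K) (B `^ p)%:E)%E).
  apply: ge0_le_integral => //.
  - apply/measurable_EFinP; apply: measurable_funTS.
    apply: (measurableT_comp (measurable_powR _)).
    by apply: measurableT_comp => //; exact: continuous_measurable_rV.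
  - by move=> x Kx; rewrite lee_fin ge0_ler_powR ?nnegrE// uB.
by rewrite integral_cst// lte_mul_pinfty ?lee_fin ?powR_ge0//; exact: compact_lty.
Qed.

Lemma locally_LpS u (v : 'rV[R]_n -> R) (p : R) : 0 <= p -> measurable_fun setT v ->
  (forall x, `|v x| <= `|u x|) -> locally_Lp setT p u -> locally_Lp setT p v.
Proof.
move=> p0 mv vu [mu_ uK]; split => // K cK KT; apply: le_lt_trans (uK K cK KT).
have mK := compact_measurable_rV cK.
have mpow (w : 'rV[R]_n -> R) : measurable_fun setT w ->
    measurable_fun K (fun x => (`|w x| `^ p)%:E).
  move=> mw; apply/measurable_EFinP; apply: measurable_funTS.
  by apply: (measurableT_comp (measurable_powR _)); exact: measurableT_comp.
apply: ge0_le_integral => //.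
- exact: mpow.
- exact: mpow.
- by move=> x Kx; rewrite lee_fin ge0_ler_powR ?nnegrE.
Qed.

(** Compact sets have finite measure, so the elementary bound [a <= 1 + a ^ p] takes the place of
    Hölder's inequality. *)
Lemma locally_Lp1 u (p : R) : 1 <= p -> locally_Lp setT p u -> locally_Lp setT 1 u.
Proof.
move=> p1 [mu_ uK]; split => // K cK KT.
have mK := compact_measurable_rV cK.
have mpow q : measurable_fun K (fun x => (`|u x| `^ q)%:E).
  apply/measurable_EFinP; apply: measurable_funTS.
  by apply: (measurableT_comp (measurable_powR _)); exact: measurableT_comp.
apply: (@le_lt_trans _ _ (\int[mu]_(x in K) (1 + (`|u x| `^ p)%:E))%E).
  apply: ge0_le_integral => //.
  - by apply: emeasurable_funD.
  - move=> x _; rewrite -EFinD lee_fin powRr1//.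
    have [u1|u1] := leP `|u x| 1; first by rewrite (le_trans u1)// lerDl powR_ge0.
    rewrite (le_trans (_ : _ <= `|u x| `^ p))// ?lerDr//.
    by rewrite -[leLHS]powRr1// ler_powR// ltW.
rewrite ge0_integralD//.
apply: lte_add_pinfty; last exact: uK.
by rewrite integral_cst// mul1e; exact: compact_lty.
Qed.
Lemma locally_LpZ (u : 'rV[R]_n -> R) (a p : R) : locally_Lp setT p u ->
  locally_Lp setT p (fun x => a * u x).
Proof.
move=> [mu_ uK]; split; first exact: measurable_funM.
move=> K cK KT; have mK := compact_measurable_rV cK.
under eq_integral => x _ do rewrite normrM powRM// EFinM.
rewrite ge0_integralZl//.
- by rewrite lte_mul_pinfty ?lee_fin ?powR_ge0// uK.
- apply/measurable_EFinP; apply: measurable_funTS.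
  by apply: (measurableT_comp (measurable_powR _)); exact: measurableT_comp.
Qed.

Lemma compact_cube (r : R) : compact [set x : 'rV[R]_n | forall i, `|x ord0 i| <= r].
Proof.
rewrite (_ : [set x | _] = [set v : 'rV[R]_n | forall i, (`[- r, r]%classic : set R) (v ord0 i)]).
  by apply: (@rV_compact R n (fun=> `[- r, r]%classic)) => _; exact: segment_compact.
by apply/seteqP; split => x /= h i; have := h i; rewrite /= in_itv/= ler_norml.
Qed.

Lemma compact_integrable_cst (K : set 'rV[R]_n) (c : R) : compact K ->
  mu.-integrable K (cst c%:E).
Proof.
move=> cK; have mK := compact_measurable_rV cK.
apply/integrableP; split; first exact: measurable_cst.
rewrite /= integral_cst//; apply: lte_mul_pinfty => //.
exact: compact_lty.
Qed.

Lemma continuous_supp_integrable (f : 'rV[R]_n -> R) (r : R) : continuous f ->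
  (forall x, f x != 0 -> forall j, `|x ord0 j| <= r) -> mu.-integrable setT (EFin \o f).
Proof.
move=> cf fr; pose K := [set x : 'rV[R]_n | forall j, `|x ord0 j| <= r].
have mK : measurable K by exact: measurable_cube.
have [B B0 fB] := continuous_compact_le cf (@compact_cube r).
have -> : EFin \o f = (EFin \o f) \_ K.
  apply/funext => x; rewrite patchE; case: ifPn => //; rewrite notin_setE => Kx /=.
  by have [->//|/fr] := eqVneq (f x) 0.
apply/(integrable_mkcond _ mK).1.
apply: (@le_integrable _ _ _ mu K mK _ (cst B%:E)).
- by apply/measurable_EFinP; apply: measurable_funTS; exact: continuous_measurable_rV.
- by move=> x Kx; rewrite /= lee_fin (ger0_norm B0) fB.
- by apply: compact_integrable_cst; exact: compact_cube.
Qed.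

End compact_rV.

(** * The Euclidean norm *)

Section enorm.
Context {R : realType} {n : nat}.
Implicit Types x y : 'rV[R]_n.

Lemma enorm_ge0 x : 0 <= enorm x.
Proof. exact: sqrtr_ge0. Qed.

Lemma enorm_sqr x : enorm x ^+ 2 = \sum_(i < n) x ord0 i ^+ 2.
Proof. by rewrite /enorm sqr_sqrtr// sumr_ge0// => i _; exact: sqr_ge0. Qed.

Lemma enorm0 : enorm (0 : 'rV[R]_n) = 0.
Proof. by rewrite /enorm big1 ?sqrtr0// => i _; rewrite mxE expr0n. Qed.

Lemma coord_le_enorm x j : `|x ord0 j| <= enorm x.
Proof.
rewrite /enorm -sqrtr_sqr ler_wsqrtr// (bigD1 j)//= lerDl.
by apply: sumr_ge0 => k _; exact: sqr_ge0.
Qed.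

Lemma enorm_eq0 x : (enorm x == 0) = (x == 0).
Proof.
apply/eqP/eqP => [x0|->]; last exact: enorm0.
apply/rowP => i; rewrite mxE; apply/eqP; rewrite -normr_eq0 eq_le normr_ge0 andbT -x0.
exact: coord_le_enorm.
Qed.

Lemma enorm_gt0 x : (0 < enorm x) = (x != 0).
Proof. by rewrite lt_neqAle enorm_ge0 andbT eq_sym enorm_eq0. Qed.

Lemma enormZ (a : R) x : enorm (a *: x) = `|a| * enorm x.
Proof.
rewrite /enorm (eq_bigr (fun i => a ^+ 2 * x ord0 i ^+ 2)); last by move=> i _; rewrite mxE exprMn.
by rewrite -mulr_sumr sqrtrM ?sqr_ge0// sqrtr_sqr.
Qed.

Lemma enorm_delta (i : 'I_n) (t : R) : enorm (t *: delta_mx ord0 i : 'rV[R]_n) = `|t|.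
Proof.
rewrite /enorm (bigD1 i)//= big1 ?addr0; last first.
  by move=> j ji; rewrite !mxE eqxx (negbTE ji) /= mulr0 expr0n.
by rewrite !mxE !eqxx mulr1 sqrtr_sqr.
Qed.

Lemma enormN x : enorm (- x) = enorm x.
Proof. by rewrite -scaleN1r enormZ normrN normr1 mul1r. Qed.

Lemma enormC x y : enorm (x - y) = enorm (y - x).
Proof. by rewrite -enormN opprB. Qed.

(** Expand the nonnegative sum of the squares of [|y| x_i - |x| y_i] and divide by [2 |x| |y|],
    whence the separate treatment of zero vectors. *)
Lemma cauchy_schwarz x y : \sum_(i < n) x ord0 i * y ord0 i <= enorm x * enorm y.
Proof.
have [->|x0] := eqVneq x 0; first by rewrite enorm0 mul0r big1// => i _; rewrite mxE mul0r.
have [->|y0] := eqVneq y 0; first by rewrite enorm0 mulr0 big1// => i _; rewrite mxE mulr0.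
rewrite -enorm_gt0 in x0; rewrite -enorm_gt0 in y0.
have : 0 <= \sum_(i < n) (enorm y * x ord0 i - enorm x * y ord0 i) ^+ 2.
  by apply: sumr_ge0 => i _; exact: sqr_ge0.
have -> : \sum_(i < n) (enorm y * x ord0 i - enorm x * y ord0 i) ^+ 2 =
    enorm y ^+ 2 * (\sum_(i < n) x ord0 i ^+ 2) + enorm x ^+ 2 * (\sum_(i < n) y ord0 i ^+ 2)
    - 2 * (enorm x * enorm y) * \sum_(i < n) x ord0 i * y ord0 i.
  rewrite !mulr_sumr -big_split/= -sumrB; apply: eq_bigr => i _; ring.
rewrite -!enorm_sqr.
have -> : enorm y ^+ 2 * enorm x ^+ 2 + enorm x ^+ 2 * enorm y ^+ 2 -
   2 * (enorm x * enorm y) * (\sum_(i < n) x ord0 i * y ord0 i) =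
   2 * (enorm x * enorm y) * (enorm x * enorm y - \sum_(i < n) x ord0 i * y ord0 i) by ring.
by rewrite pmulr_rge0 ?mulr_gt0// subr_ge0.
Qed.

Lemma enormD x y : enorm (x + y) <= enorm x + enorm y.
Proof.
rewrite -(@ler_pXn2r _ 2)// ?nnegrE ?addr_ge0 ?enorm_ge0//.
rewrite enorm_sqr sqrrD !enorm_sqr.
rewrite (eq_bigr (fun i => x ord0 i ^+ 2 + y ord0 i ^+ 2 + 2 * (x ord0 i * y ord0 i))); last first.
  by move=> i _; rewrite mxE; ring.
rewrite !big_split/= -mulr_sumr -mulr_natl.
have := cauchy_schwarz x y; lra.
Qed.

Lemma enorm_sub_norm x y : `|enorm x - enorm y| <= enorm (x - y).
Proof.
rewrite ler_norml; apply/andP; split.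
  by have := enormD (y - x) x; rewrite subrK enormC; lra.
by have := enormD (x - y) y; rewrite subrK; lra.
Qed.

Lemma norm_le_enorm x : `|x| <= enorm x.
Proof.
rewrite [leLHS]mx_normrE; apply/bigmax_leP; split; first exact: enorm_ge0.
by move=> [i j] _ /=; rewrite ord1 coord_le_enorm.
Qed.

Lemma enorm_le_norm x : enorm x <= n%:R * `|x|.
Proof.
have : x = \sum_(i < n) x ord0 i *: delta_mx ord0 i by exact: row_sum_delta.
move=> E; rewrite {1}E.
have : enorm (\sum_(i < n) x ord0 i *: delta_mx ord0 i) <= \sum_(i < n) `|x ord0 i|.
  elim/big_ind2 : _ => [|a b c d ac bd|i _]; first by rewrite enorm0.
    by rewrite (le_trans (enormD _ _))// lerD.
  by rewrite enorm_delta.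
move=> /le_trans; apply.
have -> : n%:R * `|x| = \sum_(i < n) `|x| by rewrite sumr_const card_ord mulr_natl.
apply: ler_sum => i _; rewrite [leRHS]mx_normrE.
exact: (le_bigmax_cond _ (fun ij : 'I_1 * 'I_n => `|x ij.1 ij.2|) (isT : xpredT (ord0, i))).
Qed.

Lemma continuous_enorm : continuous (@enorm R n).
Proof.
move=> x; apply/(@cvgrPdist_le _ _ _ _ (nbhs_filter x)) => eps e0.
have n1 : 0 < (n%:R + 1 : R) by rewrite ltr_wpDl.
have e1 : 0 < eps / (n%:R + 1) by rewrite divr_gt0.
have nb : \forall y \near x, `|x - y| < eps / (n%:R + 1).
  by have := nbhsx_ballx x _ e1; rewrite mx_norm_ball.
apply: filterS nb => y /ltW xy.
rewrite (le_trans (enorm_sub_norm _ _))// (le_trans (enorm_le_norm _))//.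
apply: (@le_trans _ _ ((n%:R + 1) * `|x - y|)); first by rewrite ler_wpM2r// lerDl.
by rewrite mulrC -ler_pdivlMr.
Qed.

Lemma measurable_enorm : measurable_fun setT (@enorm R n).
Proof. by apply: continuous_measurable_rV; exact: continuous_enorm. Qed.

End enorm.

(** * A criterion for Sobolev regularity *)

(** Steps of either sign are allowed: positive ones serve for [u], negative ones for the test
    function. *)
Lemma derive_seq_cvg {R : realType} {V : normedModType R} (f : V -> R^o) (x v : V) (t : nat -> R) :
  derivable f x v -> (forall k, t k != 0) -> t @ \oo --> 0 ->
  (fun k => (t k)^-1 * (f (x + t k *: v) - f x)) @ \oo --> 'D_v f x.
Proof.
move=> df tN0 t0.
have t0' : t @ \oo --> 0^'.
  move=> A A0; have tA : \forall k \near \oo, t k != 0 -> A (t k) := t0 _ A0.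
  suff : \forall k \near \oo, A (t k) by [].
  by apply: filterS tA => k /(_ (tN0 k)).
have : (fun k => (t k)^-1 *: ((f \o shift x) (t k *: v) - f x)) @ \oo --> 'D_v f x.
  exact: (cvg_comp _ _ t0' df).
rewrite (_ : (fun k => _) = (fun k => (t k)^-1 * (f (x + t k *: v) - f x)))//.
by apply/funext => k; rewrite /= (addrC x).
Qed.

(** * Difference quotients along a coordinate *)

Section difference_quotient.
Context {R : realType} {n : nat}.
Implicit Types (u : 'rV[R]_n -> R) (i : 'I_n).

(** The step runs through the sequence [1 / (k + 1)], so that upper and lower limits are measurable
    in [x]. *)
Definition diff_quot i u (k : nat) (x : 'rV[R]_n) : R :=
  k.+1%:R * (u (x + k.+1%:R^-1 *: delta_mx ord0 i) - u x).

Lemma measurable_diff_quot i u k : measurable_fun setT u ->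
  measurable_fun setT (diff_quot i u k).
Proof.
move=> mu_; apply: measurable_funM => //; apply: measurable_funB => //.
by apply: (measurableT_comp mu_); exact: measurable_add_rV.
Qed.

Lemma cvg_harmonic0 : (fun k => k.+1%:R^-1 : R) @ \oo --> 0.
Proof. exact: cvg_harmonic. Qed.

Definition dq_sup i u (x : 'rV[R]_n) : \bar R := limn_esup (fun k => (diff_quot i u k x)%:E).
Definition dq_inf i u (x : 'rV[R]_n) : \bar R := limn_einf (fun k => (diff_quot i u k x)%:E).

(** Each quotient lies between the infimum and the supremum of its tail, which tend to the lower and
    the upper limit. *)
Lemma cvg_dq_sup i u x : dq_sup i u x = dq_inf i u x ->
  (fun k => (diff_quot i u k x)%:E) @ \oo --> dq_sup i u x.
Proof.
move=> si; pose D k := (diff_quot i u k x)%:E.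
apply: (@squeeze_cvge _ _ _ _ (einfs D) _ (esups D)).
- apply: nearW => k; rewrite ereal_inf_lbound/= ?ereal_sup_ubound//=; by exists k => //=.
- rewrite si /dq_inf limn_einf_lim; exact: is_cvg_einfs.
- rewrite /dq_sup limn_esup_lim; exact: is_cvg_esups.
Qed.
End difference_quotient.

(** * Supports and Lipschitz bounds of test functions *)

Section test_functions.
Context {R : realType} {n : nat}.
Local Notation mu := (lebesgue_rV R n).
Implicit Types (phi : 'rV[R]_n -> R) (i : 'I_n).

Lemma smooth_continuous phi : smooth phi -> continuous phi.
Proof. by move=> sphi x; exact: differentiable_continuous (sphi [::] x). Qed.

Lemma smooth_partial_continuous i phi : smooth phi -> continuous (partial i phi).
Proof.
by move=> sphi x; exact: differentiable_continuous (sphi [:: i] x).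
Qed.

Lemma test_function_cube phi : test_function setT phi ->
  exists2 r : R, 0 < r & forall x, phi x != 0 -> forall i, `|x ord0 i| <= r.
Proof.
move=> [_ csupp _]; have [r r0 rK] := compact_subset_box csupp.
by exists r => // x phix; apply: rK; exact: subset_closure.
Qed.

(** The cube is closed, so [phi] vanishes on a whole neighbourhood of any point outside it. *)
Lemma partial_supp i phi (r : R) :
  (forall x, phi x != 0 -> forall j, `|x ord0 j| <= r) ->
  forall x, partial i phi x != 0 -> forall j, `|x ord0 j| <= r.
Proof.
move=> phir x; apply: contra_neqP => /existsNP[j /negP]; rewrite -ltNge => rx.
rewrite /partial (@near_eq_derive _ _ _ _ (cst 0 : 'rV[R]_n -> R^o)) ?derive_cst//.
have cj := @coord_continuous R 1 n ord0 j x.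
have : \forall y \near x, r < `|(y : 'rV[R]_n) ord0 j|.
  have cn : {for x, continuous (fun y : 'rV[R]_n => `|y ord0 j|)}.
    by apply: (continuous_comp cj); exact: norm_continuous.
  exact: cvgr_gt cn _ rx.
apply: filterS => y ry /=.
by apply/eqP; apply/negPn/negP => /phir/(_ j); rewrite leNgt ry.
Qed.

Lemma partial_bounded i phi : test_function setT phi ->
  exists2 L, 0 <= L & forall x, `|partial i phi x| <= L.
Proof.
move=> tphi; have [r r0 phir] := test_function_cube tphi; case: tphi => sphi _ _.
have [L L0 LK] := continuous_compact_le (smooth_partial_continuous (i := i) sphi)
  (@compact_cube R n r).
exists L => // x; have [->|px] := eqVneq (partial i phi x) 0; first by rewrite normr0.
by apply: LK => j; exact: partial_supp px j.
Qed.

Lemma smooth_derivable i phi x : smooth phi ->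
  derivable (phi : 'rV[R]_n -> R^o) x (delta_mx ord0 i).
Proof. by move=> sphi; apply: diff_derivable; exact: (sphi [::] x). Qed.

(** Mean value theorem on the line through [x], with the maximum of the compactly supported partial
    derivative. It dominates the difference quotients of the test function. *)
Lemma test_function_lipschitz i phi : test_function setT phi ->
  exists2 L, 0 <= L & forall x t, `|phi (x + t *: delta_mx ord0 i) - phi x| <= L * `|t|.
Proof.
move=> tphi; have [L L0 LK] := partial_bounded i tphi; case: tphi => sphi _ _.
exists L => // x.
pose f (s : R) := phi (x + s *: delta_mx ord0 i).
have fd s : is_derive (s : R^o) 1 (f : R^o -> R^o) (partial i phi (x + s *: delta_mx ord0 i)).
  have := smooth_derivable (i := i) (x := x + s *: delta_mx ord0 i) sphi.
  (* The quotients of [f] at [s] are those of [phi] at the corresponding point, so derivability and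
     the derivative carry over together. *)
  have E : (fun h : R => h^-1 *: ((f \o shift s) (h *: (1 : R^o)) - f s)) =
     (fun h : R => h^-1 *:
       (((phi : 'rV[R]_n -> R^o) \o shift (x + s *: delta_mx ord0 i))
         (h *: delta_mx ord0 i) - phi (x + s *: delta_mx ord0 i))).
    apply/funext => h; rewrite /= /f; congr (_ *: (phi _ - _)).
    by rewrite [h *: 1]mulr1 scalerDl addrCA addrC -addrA addrC.
  by move=> d; split; rewrite /derivable /derive/partial E.
have cf : continuous f.
  move=> s; have [ds _] := fd s.
  by have /derivable1_diffP/differentiable_continuous := ds.
have mvt a b : a <= b -> `|f b - f a| <= L * (b - a).
  move=> ab; have [|c _ ->] := @MVT_segment R f
    (fun s => partial i phi (x + s *: delta_mx ord0 i)) a b ab (fun y _ => fd y).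
    exact: continuous_subspaceT.
  by rewrite normrM ler_pM// ger0_norm// subr_ge0.
move=> t; have -> : phi x = f 0 by rewrite /f scale0r addr0.
rewrite -/(f t); have [t0|t0] := leP 0 t.
  by rewrite (le_trans (mvt _ _ t0))// subr0 ger0_norm.
by rewrite distrC (le_trans (mvt _ _ (ltW t0)))// sub0r ltr0_norm.
Qed.

End test_functions.

(** * Weak derivatives as limits of difference quotients *)

Section sobolev_criterion.
Context {R : realType} {n : nat}.
Local Notation mu := (lebesgue_rV R n).
Local Notation mu1 := (@lebesgue_measure R).
Variables (u M : 'rV[R]_n -> R).
Hypothesis n_ge2 : (2 <= n)%N.
Hypothesis cu : continuous u.
Hypothesis M_ge0 : forall x, 0 <= M x.
Hypothesis uM : forall x y : 'rV[R]_n, x != 0 -> `|u x - u y| <= M x * enorm (x - y).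
Hypothesis M_bounded : forall d : R, 0 < d -> exists B, forall x, d <= enorm x -> M x <= B.
Variable i : 'I_n.
Local Notation e := (delta_mx ord0 i : 'rV[R]_n).
Local Notation D := (diff_quot i u).

Let mD k : measurable_fun setT (D k).
Proof. by apply: measurable_diff_quot; exact: continuous_measurable_rV. Qed.

(** The comparison is between extended reals: a common infinite limit does not put [x] in this set,
    but away from the origin the bound by [M] excludes it. *)
Definition no_derivative : set 'rV[R]_n := [set x | dq_sup i u x != dq_inf i u x].

Lemma measurable_dq_sup : measurable_fun setT (dq_sup i u).
Proof. by apply: measurable_fun_limn_esup => k; exact/measurable_EFinP. Qed.

Lemma measurable_dq_inf : measurable_fun setT (dq_inf i u).
Proof.
rewrite (_ : dq_inf i u = fun x => - limn_esup (fun k => (- D k x)%:E))%E.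
  apply: measurableT_comp => //; apply: measurable_fun_limn_esup => k.
  by apply/measurable_EFinP; exact: measurableT_comp.
by apply/funext => x; rewrite -limn_einfN; congr limn_einf; apply/funext => k /=; rewrite opprK.
Qed.

Lemma measurable_no_derivative : measurable no_derivative.
Proof.
rewrite -[no_derivative]setCK; apply: measurableC.
rewrite (_ : ~` _ = setT `&` [set x | dq_sup i u x = dq_inf i u x]).
  exact: measurable_eqe measurable_dq_sup measurable_dq_inf.
rewrite setTI; apply/seteqP; split => x; rewrite /no_derivative /=; first by move/negP/negPn/eqP.
by move=> ->; rewrite eqxx.
Qed.

Lemma diff_quot_le k x : x != 0 -> `|D k x| <= M x.
Proof.
move=> x0; rewrite /diff_quot normrM distrC ger0_norm//.
apply: (@le_trans _ _ (k.+1%:R * (M x * enorm (x - (x + k.+1%:R^-1 *: e))))).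
  by rewrite ler_wpM2l// uM.
rewrite opprD addNKr -scaleNr enorm_delta normrN ger0_norm ?invr_ge0//.
by rewrite mulrCA divff ?mulr1.
Qed.

(** On a line in direction [i] that misses the origin some other coordinate is constant and nonzero.
    The norm is thus bounded below on the line and [M] above, so [u] is Lipschitz there and its
    quotients converge almost everywhere. *)
Lemma no_derivative_null : mu no_derivative = 0%E.
Proof.
apply: (lebesgue_rV_line_null0 n_ge2 measurable_no_derivative (i := i)) => x x0.
have [j [ji xj]] : exists j, j != i /\ x ord0 j != 0.
  apply/not_existsP => h; have /eqP := x0 (- x ord0 i); apply.
  apply/rowP => j; rewrite !mxE eqxx/=.
  have [->|ji] := eqVneq j i; first by rewrite mulr1 subrr.
  rewrite mulr0 addr0; apply/eqP/negPn/negP => xj; apply: (h j); by split.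
have xj0 : 0 < `|x ord0 j| by rewrite normr_gt0.
have [B xB] := M_bounded xj0.
have {}xB s : M (x + s *: e) <= B.
  apply: xB; rewrite (le_trans _ (coord_le_enorm _ j))// !mxE (negbTE ji) andbF mulr0 addr0//.
pose f s := u (x + s *: e).
have fL s t : `|f s - f t| <= B * `|s - t|.
  apply: le_trans (uM _ (x0 s)) _; rewrite opprD addrACA subrr add0r -scalerBl enorm_delta.
  by rewrite ler_wpM2r.
have := lipschitz_ae_derivable fL.
have mE : measurable ([set s | no_derivative (x + s *: e)] : set (RT R)).
  have mf : measurable_fun setT (fun s : RT R => x + s *: e).
    apply: measurable_rV_of_coord => k.
    rewrite (_ : (fun _ => _) = (fun s => x ord0 k + s * e ord0 k)); last first.
      by apply/funext => s; rewrite !mxE.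
    by apply: measurable_funD => //; apply: measurable_funM.
  have := mf measurableT _ measurable_no_derivative.
  by rewrite setTI.
move=> aef; apply/eqP; rewrite eq_le measure_ge0 andbT.
have [N [mN N0 subN]] := aef; rewrite -N0.
apply: le_measure; rewrite ?inE//.
apply: subset_trans subN => s /= /negP noE df; apply: noE.
have cv : (fun k => (D k (x + s *: e))%:E) @ \oo --> ('D_1 (f : R -> R^o) s)%:E.
  apply: cvg_EFin; first exact: nearW.
  have := derive_seq_cvg df (fun k => invr_neq0 (lt0r_neq0 (ltr0Sn R k))) cvg_harmonic0.
  rewrite (_ : (fun k => _) = (fun k => D k (x + s *: e)))//.
  apply/funext => k /=; rewrite invrK /diff_quot /f; congr (_ * (u _ - _)).
  by rewrite [_ *: 1]mulr1 scalerDl addrA.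
apply/eqP.
rewrite /dq_sup /dq_inf is_cvg_limn_esupE ?is_cvg_limn_einfE//; apply/cvg_ex; eexists; exact: cv.
Qed.

(* The representative vanishes on the exceptional set, so that it is bounded by
   [M] everywhere. *)
Definition derivative_rep : 'rV[R]_n -> R :=
  (fine \o dq_sup i u) \_ (~` (no_derivative `|` [set 0])).

Lemma derivative_rep_cvg x : ~ (no_derivative `|` [set 0]) x ->
  (fun k => (D k x)%:E) @ \oo --> (derivative_rep x)%:E /\ `|derivative_rep x| <= M x.
Proof.
move=> /not_orP[/negP/negPn/eqP si /eqP x0].
have cD := cvg_dq_sup si.
have bS : (`|dq_sup i u x| <= (M x)%:E)%E.
  have ca : (fun k => `|(D k x)%:E|%E) @ \oo --> `|dq_sup i u x|%E by exact: cvg_abse.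
  rewrite -(cvg_lim _ ca)//; apply: lime_le; first by apply/cvg_ex; eexists; exact: ca.
  by apply: nearW => k; rewrite lee_fin diff_quot_le.
have fS : dq_sup i u x \is a fin_num.
  by rewrite fin_numElt (_ : -oo = - +oo)%E// -lte_absl (le_lt_trans bS)// ltry.
rewrite /derivative_rep patchE mem_set; last first.
  by case=> [|/eqP]; [rewrite /no_derivative /= si eqxx|rewrite (negbTE x0)].
rewrite /= fineK//; split => //.
by rewrite -lee_fin -abse_EFin fineK.
Qed.

Lemma derivative_rep_le x : `|derivative_rep x| <= M x.
Proof.
have [xE|xE] := pselect ((no_derivative `|` [set 0]) x); last by have [] := derivative_rep_cvg xE.
by rewrite /derivative_rep patchE memNset ?normr0//=; apply.
Qed.

Lemma measurable_derivative_rep : measurable_fun setT derivative_rep.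
Proof.
apply/(measurable_restrictT _ _).1.
  apply: measurableC; apply: measurableU; first exact: measurable_no_derivative.
  by apply: compact_measurable_rV; exact: compact_set1.
apply: measurable_funTS.
exact: (measurableT_comp (fine_measurable measurableT) measurable_dq_sup).
Qed.

Lemma exceptional_null : mu (no_derivative `|` [set 0]) = 0%E.
Proof.
have m0 : measurable ([set 0] : set 'rV[R]_n) by apply: compact_measurable_rV; exact: compact_set1.
apply: null_set_setU => //.
- exact: measurable_no_derivative.
- exact: no_derivative_null.
- apply/eqP; rewrite eq_le measure_ge0 andbT -(lebesgue_rV_hyperplane i).
  apply: le_measure; rewrite ?inE//; first exact: measurable_hyperplane.
  by move=> x -> /=; rewrite mxE.
Qed.

Hypothesis M_L1 : locally_Lp setT 1 M.

Section fixed_test_function.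
Variable phi : 'rV[R]_n -> R.
Hypothesis tphi : test_function setT phi.

(** The quotient that a change of variables transfers to the test function; being backward, it tends
    to [- partial i phi]. *)
Let Dm k x := k.+1%:R * (phi (x - k.+1%:R^-1 *: e) - phi x).
Let step_le1 k (j : 'I_n) : `|(k.+1%:R^-1 *: e) ord0 j| <= 1.
Proof.
apply: le_trans (coord_le_enorm _ j) _.
by rewrite enorm_delta ger0_norm ?invr_ge0// invf_le1// ler1n.
Qed.

(** All steps have length at most 1, so one cube enlarged by 1 contains every shifted support. *)
Let shift_cube (r : R) k x : (forall j, `|(x - k.+1%:R^-1 *: e) ord0 j| <= r) ->
  forall j, `|x ord0 j| <= r + 1.
Proof.
move=> xr j; have -> : x ord0 j = (x - k.+1%:R^-1 *: e) ord0 j + (k.+1%:R^-1 *: e) ord0 j.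
  by rewrite [in RHS]mxE [X in _ + X + _]mxE subrK.
by rewrite (le_trans (ler_normD _ _))// lerD.
Qed.

Let cphi : continuous phi.
Proof. by case: tphi => sphi _ _; exact: smooth_continuous. Qed.

(** Discrete integration by parts: the term with [u (x + h) * phi x] is a translate of the one with
    [u x * phi (x - h)]. Continuity and compact support make both integrable, so the integral may be
    split. *)
Lemma diff_quot_by_parts k :
  (\int[mu]_x (D k x * phi x)%:E = \int[mu]_x (u x * Dm k x)%:E)%E.
Proof.
have [r r0 phir] := test_function_cube tphi.
set h := k.+1%:R^-1 *: e.
pose F (x : 'rV[R]_n) := k.+1%:R * (u x * phi (x - h)).
pose G (x : 'rV[R]_n) := k.+1%:R * (u x * phi x).
have iF : mu.-integrable setT (EFin \o F).
  apply: (@continuous_supp_integrable R n _ (r + 1)) => [x|x Fx j].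
    apply: (@continuousM _ _ (cst (k.+1%:R : R)) _ x); first exact: cst_continuous.
    apply: (@continuousM _ _ u _ x); first exact: cu.
    have csub : {for x, continuous (fun z : 'rV[R]_n => z - h)}.
      by apply: continuousB; [exact: cvg_id|exact: cst_continuous].
    by apply: (continuous_comp csub); exact: cphi.
  have /phir xr : phi (x - h) != 0 by apply: contra_neq Fx; rewrite /F => ->; rewrite !mulr0.
  exact: (shift_cube xr).
have iG : mu.-integrable setT (EFin \o G).
  apply: (@continuous_supp_integrable R n _ r) => [x|x Gx].
    apply: (@continuousM _ _ (cst (k.+1%:R : R)) _ x); first exact: cst_continuous.
    by apply: (@continuousM _ _ u _ x); [exact: cu|exact: cphi].
  by apply: phir; apply: contra_neq Gx; rewrite /G => ->; rewrite !mulr0.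
transitivity (\int[mu]_x ((F (x + h))%:E - (G x)%:E))%E.
  apply: eq_integral => x _; rewrite -EFinB /F /G addrK /diff_quot; congr EFin.
  by rewrite -/h; ring.
transitivity (\int[mu]_x ((F x)%:E - (G x)%:E))%E; last first.
  by apply: eq_integral => x _; rewrite -EFinB /F /G /Dm -/h; congr EFin; ring.
rewrite integralB//; last exact: (integrable_translation h iF).
rewrite integralB//; congr (_ - _)%E.
exact: (integral_translation h iF).
Qed.

(** Dominated convergence with majorant [B * M] on a cube containing the support. Convergence is
    known off the exceptional set and domination off the origin, where [M] bounds nothing. *)
Lemma diff_quot_cvg :
  (fun k => \int[mu]_x (D k x * phi x)%:E)%E @ \oo --> (\int[mu]_x (derivative_rep x * phi x)%:E)%E.
Proof.
have [r r0 phir] := test_function_cube tphi.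
pose K := [set x : 'rV[R]_n | forall j, `|x ord0 j| <= r].
have cK : compact K by exact: compact_cube.
have mK := compact_measurable_rV cK.
have [B B0 phiB] := continuous_compact_le cphi cK.
have mphi := continuous_measurable_rV cphi.
have m0 : measurable (no_derivative `|` [set 0]).
  apply: measurableU; first exact: measurable_no_derivative.
  by apply: compact_measurable_rV; exact: compact_set1.
have bnd x a : `|a| <= M x -> (`|(a * phi x)%:E| <= ((fun x => (B * M x)%:E) \_ K) x)%E.
  move=> aM; rewrite patchE; case: ifPn => [|]; rewrite ?inE ?notin_setE => Kx.
    by rewrite abse_EFin lee_fin normrM mulrC ler_pM// phiB.
  have [->|/phir//] := eqVneq (phi x) 0; first by rewrite mulr0 abse0.
have iM : mu.-integrable setT ((fun x => (B * M x)%:E) \_ K).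
  have iMK : mu.-integrable K (EFin \o M).
    have [mM /(_ K cK (@subsetT _ _)) MK] := M_L1.
    apply/integrableP; split; first by apply/measurable_EFinP; exact: measurable_funTS.
    apply: le_lt_trans MK; rewrite le_eqVlt; apply/orP; left; apply/eqP; apply: eq_integral => x _.
    by rewrite /= powRr1.
  apply/(integrable_mkcond _ mK).1.
  exact: (integrableZl mK B iMK).
have [] := @dominated_convergence _ _ _ mu setT measurableT (fun k x => (D k x * phi x)%:E)
  (fun x => (derivative_rep x * phi x)%:E) ((fun x => (B * M x)%:E) \_ K).
- by move=> k; apply/measurable_EFinP; exact: measurable_funM.
- apply/measurable_EFinP; apply: measurable_funM => //.
  exact: measurable_derivative_rep.
- exists (no_derivative `|` [set 0]); split => //.
    exact: exceptional_null.
  move=> x /= nc; apply: contrapT => xE; apply: nc => _.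
  have [cD _] := derivative_rep_cvg xE.
  by under eq_fun do rewrite EFinM; rewrite EFinM; apply: cvgeZr.
- exact: iM.
- exists [set 0]; split.
  + by apply: compact_measurable_rV; exact: compact_set1.
  + apply/eqP; rewrite eq_le measure_ge0 andbT -exceptional_null.
    apply: le_measure; [rewrite inE|by rewrite inE|by move=> x x0; right].
    by apply: compact_measurable_rV; exact: compact_set1.
  + move=> x /= nb; apply: contrapT => /eqP x0; apply: nb => k _.
    by apply: bnd; exact: diff_quot_le.
by [].
Qed.

(** Here the majorant is constant on the enlarged cube: a bound of [u] times the Lipschitz constant
    of [phi]. *)
Lemma test_quot_cvg :
  (fun k => \int[mu]_x (u x * Dm k x)%:E)%E @ \oo --> (\int[mu]_x (u x * - partial i phi x)%:E)%E.
Proof.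
have [r r0 phir] := test_function_cube tphi.
pose K := [set x : 'rV[R]_n | forall j, `|x ord0 j| <= r + 1].
have cK : compact K by exact: compact_cube.
have mK := compact_measurable_rV cK.
have [B B0 uB] := continuous_compact_le cu cK.
have [L L0 phiL] := test_function_lipschitz i tphi.
have mphi := continuous_measurable_rV cphi.
have mu_ := continuous_measurable_rV cu.
have sphi : smooth phi by case: tphi.
have bnd k x : (`|(u x * Dm k x)%:E| <= ((fun x => (B * L)%:E) \_ K) x)%E.
  rewrite patchE; case: ifPn => [|]; rewrite ?inE ?notin_setE => Kx.
    rewrite abse_EFin lee_fin normrM ler_pM ?uB//.
    rewrite /Dm normrM ger0_norm// -scaleNr.
    apply: (@le_trans _ _ (k.+1%:R * (L * `|- k.+1%:R^-1|))); first by rewrite ler_wpM2l.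
    by rewrite normrN ger0_norm ?invr_ge0// mulrCA divff ?mulr1.
  have -> : Dm k x = 0.
    rewrite /Dm; have -> : phi x = 0.
      apply/eqP/negPn/negP => /phir xr; apply: Kx => j.
      by rewrite (le_trans (xr j))// lerDl.
    have -> : phi (x - k.+1%:R^-1 *: e) = 0.
      by apply/eqP/negPn/negP => /phir xr; apply: Kx; exact: (shift_cube xr).
    by rewrite subrr mulr0.
  by rewrite mulr0 abse0.
have [] := @dominated_convergence _ _ _ mu setT measurableT (fun k x => (u x * Dm k x)%:E)
  (fun x => (u x * - partial i phi x)%:E) ((fun x => (B * L)%:E) \_ K).
- move=> k; apply/measurable_EFinP; apply: measurable_funM => //.
  apply: measurable_funM => //; apply: measurable_funB => //.
  by apply: (measurableT_comp mphi); exact: measurable_add_rV.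
- apply/measurable_EFinP; apply: measurable_funM => //; apply: measurableT_comp => //.
  by apply: continuous_measurable_rV; exact: smooth_partial_continuous.
- apply: aeW => x _; apply: cvg_EFin; first exact: nearW.
  apply: cvgM; first exact: cvg_cst.
  have tN0 k : - k.+1%:R^-1 != 0 :> R by rewrite oppr_eq0 invr_neq0.
  have t0 : (fun k => - k.+1%:R^-1 : R) @ \oo --> 0.
    by rewrite -oppr0; apply: cvgN; exact: cvg_harmonic0.
  have -> : Dm ^~ x = - (fun k => (- k.+1%:R^-1)^-1 * (phi (x + (- k.+1%:R^-1) *: e) - phi x)).
    apply/funext => k; rewrite /Dm fctE invrN invrK mulNr opprK.
    by rewrite scaleNr.
  exact: cvgN (derive_seq_cvg (smooth_derivable (i := i) (x := x) sphi) tN0 t0).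
- apply/(integrable_mkcond _ mK).1; exact: compact_integrable_cst.
- by apply: aeW => x k _; exact: bnd.
by [].
Qed.

End fixed_test_function.

(** The same sequence of integrals has the two limits just computed; the minus sign comes from the
    backward quotient. *)
Lemma weak_partial_derivative_rep : weak_partial setT i u derivative_rep.
Proof.
split; first exact: continuous_locally_Lp.
  apply: (locally_LpS _ _ _ M_L1) => //; first exact: measurable_derivative_rep.
  by move=> x; rewrite (ger0_norm (M_ge0 x)); exact: derivative_rep_le.
move=> phi tphi.
have cp : continuous (fun x => u x * partial i phi x).
  move=> x; apply: (@continuousM _ _ u _ x); first exact: cu.
  by apply: smooth_partial_continuous; case: tphi.
have [r r0 phir] := test_function_cube tphi.
have ip : mu.-integrable setT (EFin \o (fun x => u x * partial i phi x)).
  apply: (@continuous_supp_integrable R n _ r) => // x up; apply: (partial_supp (i := i) phir).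
  by apply: contra_neq up => ->; rewrite mulr0.
have c1 := diff_quot_cvg tphi.
have := test_quot_cvg tphi.
under eq_fun do rewrite -diff_quot_by_parts//.
move=> c2; have E := cvg_unique (@ereal_hausdorff R) c1 c2.
rewrite /Rintegral E //.
under [in RHS]eq_integral do rewrite mulrN EFinN.
by rewrite integralN ?fineN ?opprK//; exact: integrable_add_def.
Qed.

End sobolev_criterion.

(** * The modulus [phi] *)

Section phi.
Context {R : realType} {n : nat}.
Hypothesis n_ge2 : (2 <= n)%N.
Local Notation phi := (@phi_modulus R n).
Local Notation e := (expR 1 : R).

Lemma e_ge2 : 2 <= e.
Proof. by have := expR_ge1Dx (1 : R); lra. Qed.

(** The graph of [ln] lies below its tangent at [x]. With [x] and [y] exchanged this also bounds
    increments from below. *)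
Lemma ln_sub_le (x y : R) : 0 < x -> 0 < y -> ln y - ln x <= (y - x) / x.
Proof.
move=> x0 y0; rewrite -ln_div ?posrE//.
have -> : y / x = 1 + (y - x) / x by rewrite mulrBl divff ?gt_eqF// addrC subrK.
by apply: le_ln1Dx; rewrite mulrBl divff ?gt_eqF// ltrBrDr addrC subrr divr_gt0.
Qed.

(* [1 / phi] in the variable [t = - ln s]. *)
Definition inv_phi (t : R) : R := expR (n%:R^-1 * ln (1 + t)) * ln (e + t).

Lemma phi_expRN (t : R) : 0 <= t -> phi (expR (- t)) = (inv_phi t)^-1.
Proof.
move=> t0; rewrite /phi_modulus leNgt expR_gt0/= -[X in _ <= X]expR0 ler_expR oppr_le0 t0.
rewrite -!expRB !opprK !expRK powRN /powR gt_eqF; last by rewrite ltr_wpDr.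
by rewrite /inv_phi invfM.
Qed.

Lemma inv_phi_gt0 (t : R) : 0 <= t -> 0 < inv_phi t.
Proof. by move=> t0; rewrite mulr_gt0 ?expR_gt0// ln_gt0//; have := e_ge2; lra. Qed.

Lemma ln_e_ge1 (t : R) : 0 <= t -> 1 <= ln (e + t).
Proof.
move=> t0; rewrite -[leLHS](@expRK R) ler_ln ?posrE ?expR_gt0//; last by have := e_ge2; lra.
by rewrite lerDl.
Qed.

Let rn : 0 <= (n%:R^-1 : R) <= 2^-1.
Proof. by rewrite invr_ge0 ler0n/= lef_pV2 ?posrE ?ltr0n ?ler_nat//; apply: leq_trans n_ge2. Qed.

Lemma inv_phi_le (t t' : R) : 0 <= t -> t <= t' -> inv_phi t <= inv_phi t'.
Proof.
move=> t0 tt'; have e2 := e_ge2; have /andP[r0 _] := rn.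
apply: ler_pM; rewrite ?expR_ge0//.
- by rewrite ln_ge0//; lra.
- by rewrite ler_expR ler_wpM2l// ler_ln ?posrE//; lra.
- by rewrite ler_ln ?posrE//; lra.
Qed.

(** In logarithmic form, [phi s / s] is nonincreasing. Each factor grows at most by
    [exp ((t' - t) / 2)]: the power because [1 / n <= 1 / 2], the logarithm because its slope is at
    most [1 / e <= 1 / 2] and its value at least 1. *)
Lemma inv_phi_growth (t t' : R) : 0 <= t -> t <= t' -> inv_phi t' <= inv_phi t * expR (t' - t).
Proof.
move=> t0 tt'; have e2 := e_ge2; have /andP[r0 r2] := rn.
have -> : expR (t' - t) = expR (2^-1 * (t' - t)) * expR (2^-1 * (t' - t)).
  by rewrite -expRD; congr expR; lra.
rewrite mulrACA; apply: ler_pM; rewrite ?expR_ge0//.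
- by rewrite ln_ge0//; lra.
- rewrite -expRD ler_expR.
  have h : ln (1 + t') - ln (1 + t) <= t' - t.
    apply: (le_trans (ln_sub_le _ _)); [lra|lra|].
    by rewrite ler_pdivrMr; nra.
  have h0 : 0 <= ln (1 + t') - ln (1 + t) by rewrite subr_ge0 ler_ln ?posrE//; lra.
  by nra.
- have l1 := ln_e_ge1 t0.
  have h : ln (e + t') - ln (e + t) <= 2^-1 * (t' - t).
    apply: (le_trans (ln_sub_le _ _)); [lra|lra|].
    by rewrite ler_pdivrMr; nra.
  have := expR_ge1Dx (2^-1 * (t' - t)); nra.
Qed.

(** The power factor is nondecreasing and at least 1, so the increment of the logarithmic factor is
    a lower bound. *)
Lemma inv_phi_increment (t t' : R) : 0 <= t -> t <= t' ->
  (t' - t) / (e + t') <= inv_phi t' - inv_phi t.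
Proof.
move=> t0 tt'; have e2 := e_ge2; have /andP[r0 r2] := rn.
have A1 (x : R) : 0 <= x -> 1 <= expR (n%:R^-1 * ln (1 + x)).
  move=> x0; by rewrite -[X in X <= _](@expR0 R) ler_expR mulr_ge0// ln_ge0//; lra.
have A12 : expR (n%:R^-1 * ln (1 + t)) <= expR (n%:R^-1 * ln (1 + t')).
  by rewrite ler_expR ler_wpM2l// ler_ln ?posrE//; lra.
have h : (t' - t) / (e + t') <= ln (e + t') - ln (e + t).
  have : ln (e + t) - ln (e + t') <= (e + t - (e + t')) / (e + t') by apply: ln_sub_le; lra.
  have -> : (e + t - (e + t')) / (e + t') = - ((t' - t) / (e + t')).
    by rewrite -mulNr; congr (_ / _); lra.
  by lra.
have := A1 _ t0; have := ln_e_ge1 t0.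
have : 0 <= (t' - t) / (e + t') by rewrite divr_ge0//; lra.
rewrite /inv_phi; move: A12 h.
set a := expR _; set b := expR (_ * ln (1 + t')); set c := ln (e + t).
set d := ln (e + t'); set q := _ / _.
move=> *; nra.
Qed.

Lemma inv_phi_le2 (t : R) : 0 <= t -> inv_phi t <= (1 + t) ^+ 2.
Proof.
move=> t0; have e2 := e_ge2; have /andP[r0 r2] := rn.
rewrite expr2; apply: ler_pM; rewrite ?expR_ge0//.
- by rewrite ln_ge0//; lra.
- rewrite -[leRHS]lnK ?posrE; last lra.
  rewrite ler_expR; have : 0 <= ln (1 + t) by rewrite ln_ge0//; lra.
  by nra.
- have h : ln (e + t) - ln e <= t.
    apply: (le_trans (ln_sub_le _ _)); [lra|lra|].
    by rewrite ler_pdivrMr; nra.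
  by move: h; rewrite expRK; lra.
Qed.

(** Apply [1 + x <= exp x] at [t / 5]. The exponent 5 collects a square from each of two values of
    [inv_phi] and one factor from [e + t]. *)
Lemma poly_le_expR (t : R) : 0 <= t -> (1 + t) ^+ 5 <= 5%:R ^+ 5 * expR t.
Proof.
move=> t0; have -> : expR t = expR (t / 5%:R) ^+ 5 by rewrite -expRM_natr; congr expR; field.
rewrite -exprMn; apply: lerXn2r; rewrite ?nnegrE ?mulr_ge0 ?expR_ge0//; first lra.
have := expR_ge1Dx (t / 5%:R); lra.
Qed.

(* [5 ^ 5] comes from [(1 + t) ^ 5 <= 5 ^ 5 exp t]; the factor 2 pays for the
   passage from [t' <= t + 1] to arbitrary [t <= t']. *)
Definition phi_slope : R := (2 * e ^+ 2 * 5%:R ^+ 5)^-1.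

Lemma phi_slope_gt0 : 0 < phi_slope.
Proof. by rewrite invr_gt0 !mulr_gt0// exprn_gt0// expR_gt0. Qed.

(** The difference of reciprocals is an increment divided by a product of polynomial growth, whereas
    the left side carries a factor [exp (- t')] that absorbs any polynomial. The restriction
    [t' <= t + 1] keeps [exp (t' - t)] below [e]. *)
Lemma inv_phi_slope_near (t t' : R) : 0 <= t -> t <= t' -> t' <= t + 1 ->
  2 * phi_slope * (expR (- t) - expR (- t')) <= (inv_phi t)^-1 - (inv_phi t')^-1.
Proof.
move=> t0 tt' t1; have e2 := e_ge2.
have t'0 : 0 <= t' by lra.
have P0 := inv_phi_gt0 t0; have P'0 := inv_phi_gt0 t'0.
have PP' := inv_phi_le t0 tt'.
have -> : (inv_phi t)^-1 - (inv_phi t')^-1 = (inv_phi t' - inv_phi t) / (inv_phi t * inv_phi t').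
  by field; rewrite !gt_eqF.
rewrite ler_pdivlMr; last exact: (mulr_gt0 P0 P'0).
apply: le_trans (inv_phi_increment t0 tt').
rewrite ler_pdivlMr; last lra.
have h1 : expR (- t) - expR (- t') <= (t' - t) * (e * expR (- t')).
  have E1 : expR (- t) = expR (t' - t) * expR (- t') by rewrite -expRD; congr expR; lra.
  have h : 1 - (t' - t) <= expR (- (t' - t)) by have := expR_ge1Dx (- (t' - t)).
  have h3 : expR (t' - t) * expR (- (t' - t)) = 1 by rewrite expRxMexpNx_1.
  have h4 : expR (t' - t) <= e by rewrite ler_expR; lra.
  have h5 := expR_gt0 (t' - t); have h6 := expR_gt0 (- t').
  have h9 : expR (t' - t) - 1 <= (t' - t) * e.
    apply: (@le_trans _ _ (expR (t' - t) * (t' - t))); first by nra.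
    by rewrite mulrC ler_wpM2l//; lra.
  rewrite E1.
  have -> : expR (t' - t) * expR (- t') - expR (- t') =
    (expR (t' - t) - 1) * expR (- t') by ring.
  by rewrite mulrA ler_wpM2r ?expR_ge0.
have h2 : inv_phi t * inv_phi t' * (e + t') <= e * (5%:R ^+ 5 * expR t').
  apply: (@le_trans _ _ (e * (1 + t') ^+ 5)); last by rewrite ler_pM2l ?expR_gt0// poly_le_expR.
  have P4 : inv_phi t * inv_phi t' <= (1 + t') ^+ 2 * (1 + t') ^+ 2.
    by apply: ler_pM; rewrite ?(ltW P0) ?(ltW P'0)// ?(le_trans PP')// inv_phi_le2.
  have -> : e * (1 + t') ^+ 5 = (1 + t') ^+ 2 * (1 + t') ^+ 2 * (e * (1 + t')) by ring.
  apply: ler_pM; [by rewrite mulr_ge0 ?ltW|lra|by []|nra].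
have h7 : expR t' * expR (- t') = 1 by rewrite expRxMexpNx_1.
have h8 : 0 <= expR (- t) - expR (- t') by rewrite subr_ge0 ler_expR; lra.
have c0 := phi_slope_gt0.
have -> : 2 * phi_slope * (expR (- t) - expR (- t')) * (inv_phi t * inv_phi t') * (e + t') =
  2 * phi_slope * ((expR (- t) - expR (- t')) * (inv_phi t * inv_phi t' * (e + t'))) by ring.
apply: (@le_trans _ _
  (2 * phi_slope * ((t' - t) * (e * expR (- t')) * (e * (5%:R ^+ 5 * expR t'))))).
  rewrite ler_pM2l ?mulr_gt0//; apply: ler_pM => //.
  by apply: mulr_ge0; [exact: mulr_ge0 (ltW P0) (ltW P'0)|lra].
rewrite /phi_slope le_eqVlt; apply/orP; left; apply/eqP.
have -> : 2 * (2 * e ^+ 2 * 5%:R ^+ 5)^-1 *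
    ((t' - t) * (e * expR (- t')) * (e * (5%:R ^+ 5 * expR t'))) =
  (t' - t) * (expR t' * expR (- t')) by field; rewrite gt_eqF// expR_gt0.
by rewrite h7 mulr1.
Qed.

(** Beyond distance 1 the unit step from [t] suffices: the reciprocal of [inv_phi] keeps decreasing,
    and [exp (- t) - exp (- t - 1)] is at least half of [exp (- t)]. *)
Lemma inv_phi_slope (t t' : R) : 0 <= t -> t <= t' ->
  phi_slope * (expR (- t) - expR (- t')) <= (inv_phi t)^-1 - (inv_phi t')^-1.
Proof.
move=> t0 tt'; have c0 := phi_slope_gt0; have e2 := e_ge2.
have d0 : 0 <= expR (- t) - expR (- t') by rewrite subr_ge0 ler_expR; lra.
have [t1|t1] := leP t' (t + 1).
  by apply: le_trans (inv_phi_slope_near t0 tt' t1); rewrite -mulrA; nra.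
have := @inv_phi_slope_near t (t + 1) t0 _ (lexx _).
have h1 : t <= t + 1 by lra.
have h2 : (inv_phi t')^-1 <= (inv_phi (t + 1))^-1.
  by rewrite lef_pV2 ?posrE ?inv_phi_gt0 ?inv_phi_le//; lra.
move=> /(_ h1) h3; apply: le_trans (_ : _ <= (inv_phi t)^-1 - (inv_phi (t + 1))^-1) _; last lra.
apply: le_trans h3; rewrite -mulrA mulrCA ler_pM2l//.
have -> : expR (- (t + 1)) = expR (- t) / e by rewrite -expRB; congr expR; lra.
have h4 : expR (- t) / e <= expR (- t) / 2.
  by rewrite ler_pM2l ?expR_gt0// lef_pV2 ?posrE//; lra.
have := expR_gt0 (- t'); lra.
Qed.

Lemma phi0 : phi 0 = 0.
Proof. by rewrite /phi_modulus lexx. Qed.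

Lemma phi_ge1 (s : R) : 1 <= s -> phi s = s.
Proof.
move=> s1; rewrite /phi_modulus leNgt (lt_le_trans ltr01 s1)/=.
(* The branches meet at [s = 1], where both logarithms equal 1. *)
case: ifPn => // s1'; have -> : s = 1 by lra.
by rewrite !divr1 !expRK powR1 invr1 mulr1.
Qed.

Lemma expRN_lnN (s : R) : 0 < s -> s = expR (- - ln s).
Proof. by move=> s0; rewrite opprK lnK. Qed.

Lemma phi_gt0 (s : R) : 0 < s -> 0 < phi s.
Proof.
move=> s0; have [s1|s1] := leP s 1; last by rewrite phi_ge1 ?ltW.
have t0 : 0 <= - ln s by rewrite oppr_ge0 ln_le0.
by rewrite (expRN_lnN s0) phi_expRN// invr_gt0 inv_phi_gt0.
Qed.

Lemma phi_ge0 (s : R) : 0 <= s -> 0 <= phi s.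
Proof.
by rewrite le_eqVlt => /orP[/eqP <-|/phi_gt0/ltW//]; rewrite phi0.
Qed.

Lemma phi_ratio (a b : R) : 0 < a -> a <= b -> phi b * a <= phi a * b.
Proof.
have case1 (x y : R) : 0 < x -> x <= y -> y <= 1 -> phi y * x <= phi x * y.
  move=> x0 xy y1; have y0 : 0 < y by lra.
  have ty : 0 <= - ln y by rewrite oppr_ge0 ln_le0.
  have tyx : - ln y <= - ln x by rewrite lerN2 ler_ln ?posrE.
  have tx := le_trans ty tyx.
  have Px := phi_expRN tx; have Py := phi_expRN ty.
  rewrite -(expRN_lnN x0) in Px; rewrite -(expRN_lnN y0) in Py.
  have h := inv_phi_growth ty tyx.
  have E : expR (- ln x - - ln y) = y / x.
    by rewrite opprK addrC -ln_div ?posrE// lnK// posrE divr_gt0.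
  rewrite E in h; have P1 := inv_phi_gt0 ty; have P2 := inv_phi_gt0 tx.
  rewrite Px Py mulrC [leRHS]mulrC ler_pdivrMr// mulrAC ler_pdivlMr//.
  by move: h; rewrite mulrA ler_pdivlMr//; lra.
move=> a0 ab; have [b1|b1] := leP b 1; first exact: case1.
rewrite (phi_ge1 (ltW b1)) mulrC.
have [a1|a1] := leP a 1; last by rewrite (phi_ge1 (ltW a1)).
rewrite ler_pM2r; last lra.
by have := case1 a 1 a0 a1 (lexx _); rewrite (phi_ge1 (lexx _)) mul1r mulr1.
Qed.

Lemma phi_ge_id (s : R) : 0 <= s -> s <= phi s.
Proof.
rewrite le_eqVlt => /orP[/eqP <-|s0]; first by rewrite phi0.
have [s1|s1] := leP s 1; last by rewrite (phi_ge1 (ltW s1)).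
by have := phi_ratio s0 s1; rewrite (phi_ge1 (lexx _)) mul1r mulr1.
Qed.

Lemma phi_slope_le1 : phi_slope <= 1.
Proof.
have e2 := e_ge2; rewrite /phi_slope invf_le1 ?mulr_gt0 ?exprn_gt0 ?expR_gt0//.
by rewrite -mulrA; nra.
Qed.

(** Logarithmic coordinates cover [0 < a <= b <= 1]. An interval across 1 is split there, since the
    slope is 1 beyond, and [a = 0] follows from [b <= phi b]. *)
Lemma phi_slopeP (a b : R) : 0 <= a -> a <= b -> phi_slope * (b - a) <= phi b - phi a.
Proof.
have c0 := phi_slope_gt0; have e2 := e_ge2.
have c1 := phi_slope_le1.
have case1 (x y : R) : 0 < x -> x <= y -> y <= 1 -> phi_slope * (y - x) <= phi y - phi x.
  move=> x0 xy y1; have y0 : 0 < y by lra.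
  have ty : 0 <= - ln y by rewrite oppr_ge0 ln_le0.
  have tyx : - ln y <= - ln x by rewrite lerN2 ler_ln ?posrE.
  have tx := le_trans ty tyx.
  have Px := phi_expRN tx; have Py := phi_expRN ty.
  rewrite -(expRN_lnN x0) in Px; rewrite -(expRN_lnN y0) in Py.
  by have := inv_phi_slope ty tyx; rewrite Px Py -(expRN_lnN x0) -(expRN_lnN y0).
have case2 (x y : R) : 0 < x -> x <= y -> phi_slope * (y - x) <= phi y - phi x.
  move=> x0 xy; have [y1|y1] := leP y 1; first exact: case1.
  rewrite (phi_ge1 (ltW y1)); have [x1|x1] := leP x 1; last by rewrite (phi_ge1 (ltW x1)); nra.
  have := case1 x 1 x0 x1 (lexx _); rewrite (phi_ge1 (lexx _)); nra.
rewrite le_eqVlt => /orP[/eqP <-|a0 ab]; last exact: case2.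
by move=> b0; rewrite phi0 !subr0; have := phi_ge_id b0; nra.
Qed.

Lemma phi_le (a b : R) : 0 <= a -> a <= b -> phi a <= phi b.
Proof.
by move=> a0 ab; have := phi_slopeP a0 ab; have := phi_slope_gt0; nra.
Qed.

Lemma phi_small (eps : R) : 0 < eps -> exists2 d, 0 < d & phi d <= eps.
Proof.
(* The choice makes the factor [ln (e + t)] of [inv_phi t] at least [1 / eps], without using the
   power factor. *)
move=> e0; pose t := expR eps^-1.
have t0 : 0 <= t by exact: expR_ge0.
exists (expR (- t)); first exact: expR_gt0.
rewrite phi_expRN// -[leRHS]invrK lef_pV2 ?posrE ?invr_gt0 ?inv_phi_gt0//.
have e2 := e_ge2; have /andP[r0 r2] := rn.
have h : eps^-1 <= ln (e + t).
  by rewrite -[leLHS]expRK ler_ln ?posrE ?expR_gt0//; [rewrite /t lerDr; lra|lra].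
apply: (le_trans h); rewrite /inv_phi -[leLHS]mul1r ler_wpM2r ?ln_ge0//; first lra.
by rewrite -[X in X <= _](@expR0 R) ler_expR mulr_ge0// ln_ge0//; lra.
Qed.

(** The exponent [1 / n] is critical: the [n]-th power leaves [1 + t], and convergence of the energy
    rests on the logarithm. *)
Lemma phi_expRN_pow (t : R) : 0 <= t -> phi (expR (- t)) ^+ n = ((1 + t) * ln (e + t) ^+ n)^-1.
Proof.
move=> t0; rewrite phi_expRN// exprVn; congr (_^-1).
rewrite /inv_phi exprMn -expRM_natl mulrA divff ?mul1r; last first.
  by rewrite pnatr_eq0 -lt0n; apply: leq_trans n_ge2.
by rewrite lnK// posrE; lra.
Qed.
End phi.

(** * The radial stretchings *)

Section radial.
Context {R : realType} {n : nat}.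
Hypothesis n_ge2 : (2 <= n)%N.
Local Notation phi := (@phi_modulus R n).
Local Notation c := (@phi_slope R).
Implicit Types (l r s : R).

(* Junk value: [gam 0 = 0]. *)
Definition gam r : R := phi r / r.

Lemma gam_ge0 r : 0 <= r -> 0 <= gam r.
Proof. by move=> r0; rewrite divr_ge0// phi_ge0. Qed.

Lemma gam_ge1 r : 0 < r -> 1 <= gam r.
Proof. by move=> r0; rewrite ler_pdivlMr// mul1r (phi_ge_id n_ge2)// ltW. Qed.

Lemma gam_le a b : 0 < a -> a <= b -> gam b <= gam a.
Proof.
move=> a0 ab; have b0 := lt_le_trans a0 ab.
by rewrite ler_pdivrMr// mulrAC ler_pdivlMr// (phi_ratio n_ge2).
Qed.

Lemma gamM r : 0 < r -> gam r * r = phi r.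
Proof. by move=> r0; rewrite divfK ?gt_eqF. Qed.

(** A substitute for concavity, obtained from the monotonicity of [gam] alone. *)
Lemma phi_sub_le a b : 0 < a -> a <= b -> phi b - phi a <= gam a * (b - a).
Proof.
move=> a0 ab; have b0 := lt_le_trans a0 ab.
by have := gam_le a0 ab; rewrite -(gamM a0) -(gamM b0); nra.
Qed.

Definition stretch l r : R := (1 - l) * r + l * phi r.

Section stretch.
Variable l : R.
Hypothesis l01 : 0 <= l <= 1.

Lemma stretch_slope a b : 0 <= a -> a <= b -> c * (b - a) <= stretch l b - stretch l a.
Proof.
move=> a0 ab; have h1 := phi_slopeP n_ge2 a0 ab.
have h2 : c * (b - a) <= b - a by rewrite ler_piMl ?phi_slope_le1 ?subr_ge0.
by rewrite /stretch; case/andP: l01; nra.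
Qed.

Lemma stretch_sub_le a b : 0 < a -> a <= b -> stretch l b - stretch l a <= gam a * (b - a).
Proof.
move=> a0 ab; have h1 := phi_sub_le a0 ab.
have h2 : b - a <= gam a * (b - a) by rewrite ler_peMl ?gam_ge1 ?subr_ge0.
by rewrite /stretch; case/andP: l01; nra.
Qed.

Lemma stretch_le_phi r : 0 <= r -> stretch l r <= phi r.
Proof. by move=> r0; have := phi_ge_id n_ge2 r0; rewrite /stretch; case/andP: l01; nra. Qed.

Lemma stretch_ge_id r : 0 <= r -> r <= stretch l r.
Proof. by move=> r0; have := phi_ge_id n_ge2 r0; rewrite /stretch; case/andP: l01; nra. Qed.

Lemma stretch0 : stretch l 0 = 0.
Proof. by rewrite /stretch phi0 !mulr0 addr0. Qed.

Lemma stretch_lip (d a b : R) : 0 < d -> d <= a -> d <= b ->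
  `|stretch l a - stretch l b| <= gam d * `|a - b|.
Proof.
have main x y : 0 < d -> d <= x -> x <= y -> `|stretch l x - stretch l y| <= gam d * `|x - y|.
  move=> d0 dx xy; have x0 := lt_le_trans d0 dx.
  have h1 : stretch l x <= stretch l y.
    by have := stretch_slope (ltW x0) xy; have := @phi_slope_gt0 R; nra.
  rewrite (distrC x) (distrC (stretch l x)) !ger0_norm ?subr_ge0//.
  apply: le_trans (stretch_sub_le x0 xy) _.
  by rewrite ler_wpM2r ?subr_ge0//; exact: gam_le.
move=> d0 da db; have [ab|/ltW ba] := leP a b; first exact: main.
by rewrite distrC (distrC a); exact: main.
Qed.

Lemma stretch_surj s : 0 <= s -> exists r, 0 <= r /\ stretch l r = s.
Proof.
rewrite le_eqVlt => /orP[/eqP <-|s0]; first by exists 0; rewrite stretch0.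
have [d d0 ds] := phi_small n_ge2 s0.
have ds' : d <= s by rewrite (le_trans _ ds)// (phi_ge_id n_ge2)// ltW.
(* The stretching is Lipschitz only away from 0; freezing it below [d] gives a globally Lipschitz
   function. As [phi d <= s], the value [s] is still attained between [d] and [s]. *)
pose f r := stretch l (Num.max d r).
have fL x y : `|f x - f y| <= gam d * `|x - y|.
  apply: (le_trans (stretch_lip d0 _ _)); rewrite ?le_max ?lexx//.
  rewrite ler_wpM2l ?gam_ge0 ?(ltW d0)//.
  rewrite /Num.max; case: ltP => h1; case: ltP => h2 //.
  - by rewrite !ger0_norm; lra.
  - by rewrite distrC (distrC x) !ger0_norm; lra.
  - by rewrite subrr normr0.
have [||r] := @IVT R f d s s ds'.
- by apply: continuous_subspaceT; exact: lipschitz_continuous fL.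
- rewrite /f maxxx (max_r ds') ge_min le_max.
  by rewrite (le_trans (stretch_le_phi (ltW d0)) ds)/= (stretch_ge_id (ltW s0)) orbT.
move=> rs <-; exists (Num.max d r); split=> //.
by rewrite le_max (ltW d0).
Qed.

End stretch.

Definition unstretch l s : R := get [set r | 0 <= r /\ stretch l r = s].

Lemma unstretchP l s : 0 <= l <= 1 -> 0 <= s -> 0 <= unstretch l s /\ stretch l (unstretch l s) = s.
Proof.
move=> l01 s0; have [r rs] := stretch_surj l01 s0.
exact: (@getPex _ [set r | 0 <= r /\ stretch l r = s] (ex_intro _ r rs)).
Qed.

Lemma stretch_inj l a b : 0 <= l <= 1 -> 0 <= a -> 0 <= b -> stretch l a = stretch l b -> a = b.
Proof.
move=> l01; wlog ab : a b / a <= b.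
  by move=> w a0 b0 E; have [ab|/ltW ba] := leP a b; [exact: w|apply/esym; exact: w].
move=> a0 b0 E; have := stretch_slope l01 a0 ab; rewrite E subrr => h.
by apply/le_anti; rewrite ab /=; have := @phi_slope_gt0 R; nra.
Qed.

Lemma stretchK l r : 0 <= l <= 1 -> 0 <= r -> unstretch l (stretch l r) = r.
Proof.
move=> l01 r0; have [u0 uE] := unstretchP l01 (le_trans r0 (stretch_ge_id l01 r0)).
exact: stretch_inj uE.
Qed.

Lemma expand_norm l a b : 0 <= l <= 1 -> 0 <= a -> 0 <= b ->
  c * `|a - b| <= `|stretch l a - stretch l b|.
Proof.
move=> l01; wlog ab : a b / a <= b.
  move=> w a0 b0; have [ab|/ltW ba] := leP a b; first exact: w.
  by rewrite distrC (distrC (stretch l a)); exact: w.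
move=> a0 b0; rewrite distrC (distrC (stretch l a)) ger0_norm ?subr_ge0//.
by rewrite (le_trans (stretch_slope l01 a0 ab))// ler_norm.
Qed.

(* The family [g_l] for [- 1 <= l <= 1]. *)
Definition rad l r : R := if 0 <= l then stretch l r else unstretch (- l) r.

Lemma rad_cases l : `|l| <= 1 -> (0 <= l <= 1) \/ (l < 0 /\ 0 <= - l <= 1).
Proof.
rewrite ler_norml => /andP[l1 l2]; have [l0|l0] := leP 0 l; [left|right]; first by rewrite l2.
by split => //; apply/andP; split; lra.
Qed.

Lemma rad_bounds l r : `|l| <= 1 -> 0 <= r -> 0 <= rad l r <= phi r.
Proof.
move=> /rad_cases[l01|[l0 l01]] r0; rewrite /rad.
  case/andP: (l01) => -> _; rewrite stretch_le_phi// andbT.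
  by rewrite (le_trans r0)// stretch_ge_id.
rewrite (leNgt 0 l) l0 /=; have [u0 uE] := unstretchP l01 r0; rewrite u0/=.
by rewrite (le_trans (stretch_ge_id l01 u0))// uE (phi_ge_id n_ge2).
Qed.

Lemma radK l r : `|l| <= 1 -> 0 <= r -> rad (- l) (rad l r) = r.
Proof.
move=> /rad_cases[l01|[l0 l01]] r0; rewrite /rad.
  case/andP: (l01) => l0 _; rewrite l0 oppr_ge0 opprK; case: ifPn => l0'.
    have -> : l = 0 by lra.
    by rewrite oppr0 /stretch !subr0 !mul1r !mul0r !addr0.
  exact: stretchK.
by rewrite (leNgt 0 l) l0/= oppr_ge0 (ltW l0); case: (unstretchP l01 r0).
Qed.

Lemma rad1 r : rad 1 r = phi r.
Proof. by rewrite /rad ler01 /stretch subrr mul0r add0r mul1r. Qed.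

Lemma rad_r0 l : `|l| <= 1 -> rad l 0 = 0.
Proof. by move=> l1; have := rad_bounds l1 (lexx 0); rewrite phi0 => /le_anti <-. Qed.

Lemma rad_gt0 l r : `|l| <= 1 -> 0 < r -> 0 < rad l r.
Proof.
move=> l1 r0; rewrite lt_neqAle; case/andP: (rad_bounds l1 (ltW r0)) => -> _; rewrite andbT.
apply/eqP => E; have := radK l1 (ltW r0); rewrite -E rad_r0 ?normrN// => r0'.
by rewrite -r0' ltxx in r0.
Qed.

Lemma rad_ge1 l r : `|l| <= 1 -> 1 <= r -> rad l r = r.
Proof.
move=> l1 r1; have st k : stretch k r = r by rewrite /stretch (phi_ge1 r1); ring.
case: (rad_cases l1) => [l01|[l0 l01]]; rewrite /rad; first by case/andP: l01 => ->.
by rewrite (leNgt 0 l) l0/= -{1}(st (- l)) stretchK//; lra.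
Qed.

(** For [l >= 0] the upper slope bound [gam r] applies. For [l < 0] the inverse has Lipschitz
    constant [c^-1], and [gam r >= 1] lets one bound cover both. *)
Lemma rad_lip_r l r r' : `|l| <= 1 -> 0 < r -> r <= r' ->
  `|rad l r - rad l r'| <= c^-1 * gam r * `|r - r'|.
Proof.
have c0 := @phi_slope_gt0 R; have c1 := @phi_slope_le1 R.
move=> l1 r0 rr'; have r'0 := lt_le_trans r0 rr'; have g1 := gam_ge1 r0.
have ci : 1 <= c^-1 by rewrite invf_ge1.
case: (rad_cases l1) => [l01|[l0 l01]]; rewrite /rad.
  case/andP: (l01) => -> _; apply: (le_trans (stretch_lip l01 r0 (lexx _) rr')).
  by rewrite ler_wpM2r//; nra.
rewrite (leNgt 0 l) l0/=.
have [u0 uE] := unstretchP l01 (ltW r0); have [u0' uE'] := unstretchP l01 (ltW r'0).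
have := expand_norm l01 u0 u0'; rewrite uE uE'.
rewrite -mulrA ler_pdivlMl// => h; apply: (le_trans h).
by rewrite ler_peMl.
Qed.

Lemma stretch_lip_l l l' r : 0 <= r -> `|stretch l r - stretch l' r| <= `|l - l'| * phi r.
Proof.
move=> r0; have -> : stretch l r - stretch l' r = (l - l') * (phi r - r) by rewrite /stretch; ring.
have := phi_ge_id n_ge2 r0 => h.
rewrite normrM ler_wpM2l// ger0_norm ?subr_ge0//; lra.
Qed.

(** With [u] and [u'] the two preimages of [r], expansion of [stretch l] reduces the claim to
    comparing [stretch l u'] with [stretch l' u' = r], and [u' <= r]. *)
Lemma unstretch_lip_l l l' r : 0 <= l <= 1 -> 0 <= l' <= 1 -> 0 <= r ->
  `|unstretch l r - unstretch l' r| <= c^-1 * (`|l - l'| * phi r).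
Proof.
move=> l01 l01' r0; have c0 := @phi_slope_gt0 R.
have [u0 uE] := unstretchP l01 r0; have [u0' uE'] := unstretchP l01' r0.
rewrite ler_pdivlMl//; apply: (le_trans (expand_norm l01 u0 u0')).
rewrite uE -[X in `|X - _|]uE' (distrC l).
apply: (le_trans (stretch_lip_l _ _ u0')).
rewrite ler_wpM2l// (phi_le n_ge2)//.
by rewrite -[leRHS]uE' stretch_ge_id.
Qed.

Lemma rad_lip_l l l' r : `|l| <= 1 -> `|l'| <= 1 -> 0 <= r ->
  `|rad l r - rad l' r| <= c^-1 * (`|l - l'| * phi r).
Proof.
move=> l1 l1' r0; have c0 := @phi_slope_gt0 R; have c1 := @phi_slope_le1 R.
have ci : 1 <= c^-1 by rewrite invf_ge1.
have p0 := phi_ge0 r0.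
have same (k k' : R) : 0 <= k <= 1 -> 0 <= k' <= 1 ->
    `|rad k r - rad k' r| <= c^-1 * (`|k - k'| * phi r).
  move=> /andP[k0 _] /andP[k0' _]; rewrite /rad k0 k0'.
  by apply: (le_trans (stretch_lip_l _ _ r0)); rewrite ler_peMl// mulr_ge0.
have radE (k : R) : k <= 0 -> `|k| <= 1 -> rad k r = unstretch (- k) r.
  move=> k0 k1; rewrite /rad; case: ifP => // k0'; have -> : k = 0 by lra.
  rewrite oppr0 -{2}(_ : stretch 0 r = r) ?stretchK ?lexx ?ler01//.
    by rewrite /stretch subr0 mul1r mul0r addr0.
  by rewrite /stretch subr0 mul1r mul0r addr0.
have same' (k k' : R) : k <= 0 -> k' <= 0 -> `|k| <= 1 -> `|k'| <= 1 ->
    `|rad k r - rad k' r| <= c^-1 * (`|k - k'| * phi r).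
  move=> k0 k0' k1 k1'; rewrite !radE//.
  have -> : `|k - k'| = `|- k - - k'| by rewrite -opprD normrN.
  apply: unstretch_lip_l => //.
    by rewrite oppr_ge0 k0 -(ler0_norm k0).
  by rewrite oppr_ge0 k0' -(ler0_norm k0').
(* Parameters of opposite signs are joined through 0, where both branches are the identity;
   [|k - k'|] is additive there. *)
have mixed (k k' : R) : k <= 0 -> 0 <= k' -> `|k| <= 1 -> `|k'| <= 1 ->
    `|rad k r - rad k' r| <= c^-1 * (`|k - k'| * phi r).
  move=> k0 k0' k1 k1'.
  have h1 := same' k 0 k0 (lexx _) k1 (_ : `|0| <= 1).
  have h2 := same 0 k' (_ : 0 <= 0 <= 1) (_ : 0 <= k' <= 1).
  rewrite (le_trans (ler_distD (rad 0 r) _ _))//.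
  have -> : `|k - k'| = `|k - 0| + `|0 - k'|.
    by rewrite subr0 sub0r normrN (ler0_norm k0) (ger0_norm k0') ler0_norm; lra.
  rewrite mulrDl mulrDr lerD//; first by apply: h1; rewrite normr0.
  by apply: h2; rewrite ?lexx ?ler01// k0' (le_trans (ler_norm _) k1').
have [l0|/ltW l0] := leP 0 l; have [l0'|/ltW l0'] := leP 0 l'.
- by apply: same; rewrite ?l0 ?l0' (le_trans (ler_norm _)).
- by rewrite distrC (distrC l); exact: mixed.
- exact: mixed.
- exact: same'.
Qed.

Lemma rad_lip l l' r r' : `|l| <= 1 -> `|l'| <= 1 -> 0 < r -> r <= r' ->
  `|rad l r - rad l' r'| <= c^-1 * gam r * (`|r - r'| + r * `|l - l'|).
Proof.
move=> l1 l1' r0 rr'; rewrite (le_trans (ler_distD (rad l' r) _ _))// addrC mulrDr lerD//.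
  exact: rad_lip_r.
apply: (le_trans (rad_lip_l l1 l1' (ltW r0))); rewrite -(gamM r0).
by rewrite le_eqVlt; apply/orP; left; apply/eqP; ring.
Qed.
End radial.

Section radial_map.
Context {R : realType} {n : nat}.
Hypothesis n_ge2 : (2 <= n)%N.
Local Notation phi := (@phi_modulus R n).
Local Notation gam := (@gam R n).
Local Notation c := (@phi_slope R).
Local Notation rad := (@rad R n).
Variable i0 : 'I_n.
Implicit Types (x y : 'rV[R]_n).

(** [sg] is 1 or -1: the sign selects the coordinate or its opposite, hence the map or its
    inverse. *)
Definition latitude (sg : R) x : R := sg * x ord0 i0 / enorm x.

Definition radial_map (sg : R) x : 'rV[R]_n := (rad (latitude sg x) (enorm x) / enorm x) *: x.

Section sign.
Variable sg : R.
Hypothesis sg1 : `|sg| = 1.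

Lemma latitude_le1 x : `|latitude sg x| <= 1.
Proof.
rewrite /latitude !normrM sg1 mul1r.
have [->|x0] := eqVneq x 0; first by rewrite mxE normr0 mul0r ler01.
rewrite -enorm_gt0 in x0.
rewrite (ger0_norm (_ : 0 <= (enorm x)^-1)) ?invr_ge0 ?enorm_ge0//.
by rewrite ler_pdivrMr// mul1r coord_le_enorm.
Qed.

Lemma enorm_radial_map x : enorm (radial_map sg x) = rad (latitude sg x) (enorm x).
Proof.
rewrite /radial_map enormZ.
have /andP[r0 _] := rad_bounds n_ge2 (latitude_le1 x) (enorm_ge0 x).
have [->|x0] := eqVneq x 0.
  by rewrite enorm0 mulr0 (rad_r0 n_ge2)//; have := latitude_le1 0.
rewrite -enorm_gt0 in x0.
by rewrite ger0_norm ?divr_ge0 ?enorm_ge0// divfK// gt_eqF.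
Qed.

Lemma radial_map0 : radial_map sg 0 = 0.
Proof. by rewrite /radial_map scaler0. Qed.

Lemma latitude_radial_map x : x != 0 -> latitude sg (radial_map sg x) = latitude sg x.
Proof.
move=> x0; rewrite {1}/latitude enorm_radial_map /radial_map mxE.
have x1 : 0 < enorm x by rewrite enorm_gt0.
have r0 : 0 < rad (latitude sg x) (enorm x) by apply: (rad_gt0 n_ge2) => //; exact: latitude_le1.
rewrite /latitude.
move: r0; set a := rad _ _ => r0; field; lra.
Qed.

Lemma latitudeN x : latitude (- sg) x = - latitude sg x.
Proof. by rewrite /latitude !mulNr. Qed.

(** The image stays on the ray of [x], so the second map sees the opposite latitude and [radK]
    applies on that ray. *)
Lemma radial_mapK x : radial_map (- sg) (radial_map sg x) = x.
Proof.
have [->|x0] := eqVneq x 0; first by rewrite radial_map0 /radial_map scaler0.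
have x1 : 0 < enorm x by rewrite enorm_gt0.
have r0 : 0 < rad (latitude sg x) (enorm x) by apply: (rad_gt0 n_ge2) => //; exact: latitude_le1.
rewrite {1}/radial_map latitudeN latitude_radial_map// enorm_radial_map.
rewrite (radK n_ge2) ?latitude_le1 ?enorm_ge0// /radial_map scalerA.
rewrite [X in X *: _](_ : _ = 1) ?scale1r//.
move: r0; set a := rad _ _ => r0; field; lra.
Qed.

Lemma radial_map_ge1 x : 1 <= enorm x -> radial_map sg x = x.
Proof.
move=> x1; rewrite /radial_map (rad_ge1 n_ge2) ?latitude_le1// divff ?scale1r//; lra.
Qed.

Lemma enorm_radial_map_le x : enorm (radial_map sg x) <= phi (enorm x).
Proof.
rewrite enorm_radial_map.
by have /andP[_ ->] := rad_bounds n_ge2 (latitude_le1 x) (enorm_ge0 x).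
Qed.

(** In polar form the difference is an angular term plus a radial one. As [r |th - th'| <= 2 d], the
    angular term contributes 2, and the radial one 1 from the radii and 2 from the latitudes. *)
Lemma radial_map_lip_min x y : x != 0 -> enorm x <= enorm y ->
  enorm (radial_map sg x - radial_map sg y) <= 5 * c^-1 * gam (enorm x) * enorm (x - y).
Proof.
move=> x0 xy; rewrite -enorm_gt0 in x0; have y0 := lt_le_trans x0 xy.
set r := enorm x; set r' := enorm y; set d := enorm (x - y).
set l := latitude sg x; set l' := latitude sg y.
have l1 : `|l| <= 1 := latitude_le1 x; have l1' : `|l'| <= 1 := latitude_le1 y.
pose th := r^-1 *: x; pose th' := r'^-1 *: y.
have th1 : enorm th' = 1.
  by rewrite /th' enormZ ger0_norm ?invr_ge0 ?enorm_ge0// mulVf// gt_eqF.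
have rd : `|r - r'| <= d := enorm_sub_norm x y.
have rth : r * enorm (th - th') <= 2 * d.
  rewrite -[X in X * _ <= _]ger0_norm ?(ltW x0)// -enormZ.
  have -> : r *: (th - th') = (x - y) + (r' - r) *: th'.
    rewrite scalerBr scalerBl /th /th' !scalerA !divff ?gt_eqF// !scale1r.
    by rewrite addrA subrK.
  rewrite (le_trans (enormD _ _))// enormZ th1 mulr1 (distrC r') -/d; lra.
have lth : `|l - l'| <= enorm (th - th').
  have -> : l - l' = sg * (th - th') ord0 i0.
    by rewrite /l /l' /latitude /th /th' !mxE -/r -/r'; ring.
  by rewrite normrM sg1 mul1r coord_le_enorm.
have -> : radial_map sg x - radial_map sg y =
    rad l r *: (th - th') + (rad l r - rad l' r') *: th'.
  rewrite /radial_map -/l -/l' -/r -/r' /th /th' scalerBr scalerBl !scalerA.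
  by rewrite addrA subrK.
have /andP[R0 Rphi] := rad_bounds n_ge2 l1 (ltW x0).
rewrite (le_trans (enormD _ _))// (enormZ (rad l r)).
rewrite (enormZ (rad l r - rad l' r')) th1 mulr1 (ger0_norm R0).
have h1 : rad l r * enorm (th - th') <= gam r * (2 * d).
  apply: (@le_trans _ _ (gam r * r * enorm (th - th'))).
    by rewrite ler_wpM2r ?enorm_ge0// (gamM (n := n) x0).
  by rewrite -mulrA ler_wpM2l// gam_ge0// ltW.
have h2 := rad_lip n_ge2 l1 l1' x0 xy.
have c0 := @phi_slope_gt0 R; have c1 := @phi_slope_le1 R.
have ci : 1 <= c^-1 by rewrite invf_ge1.
have g1 := gam_ge1 n_ge2 x0.
have h3 : `|r - r'| + r * `|l - l'| <= 3 * d.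
  have : r * `|l - l'| <= r * enorm (th - th') by rewrite ler_wpM2l// ltW.
  lra.
have h4 : c^-1 * gam r * (`|r - r'| + r * `|l - l'|) <= c^-1 * gam r * (3 * d).
  by rewrite ler_wpM2l// mulr_ge0//; lra.
have d0 : 0 <= d := enorm_ge0 _.
have h5 : gam r * (2 * d) <= c^-1 * gam r * (2 * d).
  by rewrite ler_wpM2r ?mulr_ge0// ler_peMl//; lra.
rewrite -/r -/r' -/d in h2 *; lra.
Qed.

(** The bound must depend on [x] alone, as the Sobolev criterion requires. If [y] is shorter but
    near, [|y| >= |x| / 2] costs a factor 2 in [gam]; if it is far, both images have norm at most
    [phi |x|] and [|x - y| > |x| / 2]. *)
Lemma radial_map_lip x y : x != 0 ->
  enorm (radial_map sg x - radial_map sg y) <= 10 * c^-1 * gam (enorm x) * enorm (x - y) .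
Proof.
move=> x0.
have x1 : 0 < enorm x by rewrite enorm_gt0.
have c0 := @phi_slope_gt0 R; have c1 := @phi_slope_le1 R.
have ci : 1 <= c^-1 by rewrite invf_ge1.
have g1 := gam_ge1 n_ge2 x1.
have d0 := enorm_ge0 (x - y).
have [xy|yx] := leP (enorm x) (enorm y).
  apply: le_trans (radial_map_lip_min x0 xy) _; rewrite !ler_wpM2r//; lra.
have := enorm_sub_norm x y; rewrite ler_norml => /andP[_ dxy].
have [near|far] := leP (enorm (x - y)) (enorm x / 2).
  have y1 : enorm x / 2 <= enorm y by lra.
  have y0 : y != 0 by rewrite -enorm_gt0; lra.
  rewrite enormC; apply: le_trans (radial_map_lip_min y0 (ltW yx)) _.
  rewrite enormC ler_wpM2r//.
  have : gam (enorm y) <= 2 * gam (enorm x).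
    have y2 : 0 < enorm y by lra.
    have : phi (enorm y) <= phi (enorm x) by apply: (phi_le n_ge2); lra.
    by rewrite -(gamM (n := n) y2) -(gamM (n := n) x1); have := gam_ge0 (n := n) (ltW y2); nra.
  move=> h; have : c^-1 * gam (enorm y) <= c^-1 * (2 * gam (enorm x)) by rewrite ler_wpM2l//; lra.
  lra.
apply: (@le_trans _ _ (2 * phi (enorm x))).
  have h1 := enormD (radial_map sg x) (- radial_map sg y).
  rewrite enormN in h1.
  have h2 := enorm_radial_map_le x; have h3 := enorm_radial_map_le y.
  have h4 : phi (enorm y) <= phi (enorm x) by apply: (phi_le n_ge2); rewrite ?enorm_ge0 ?ltW.
  lra.
rewrite -(gamM (n := n) x1).
have : gam (enorm x) <= c^-1 * gam (enorm x) by rewrite ler_peMl//; lra.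
nra.
Qed.

(** With [x] the longer point, [|x - y| / 2 <= |x|], so [gam |x|] is at most [gam] at half the
    distance; this doubles the constant 10. *)
Lemma radial_map_modulus x y :
  enorm (radial_map sg x - radial_map sg y) <= 20 * c^-1 * phi (enorm (x - y)).
Proof.
wlog xy : x y / enorm y <= enorm x.
  move=> w; have [xy|/ltW xy] := leP (enorm y) (enorm x); first exact: w.
  by rewrite enormC (enormC x); exact: w.
have c0 := @phi_slope_gt0 R.
have ci0 : 0 < c^-1 by rewrite invr_gt0.
have [x0|x0] := eqVneq x 0.
  have y0 : y = 0 by apply/eqP; rewrite -enorm_eq0 eq_le enorm_ge0 andbT (le_trans xy)// x0 enorm0.
  by rewrite x0 y0 !subrr enorm0 phi0 mulr0.
have x1 : 0 < enorm x by rewrite enorm_gt0.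
have [->|xny] := eqVneq x y; first by rewrite !subrr enorm0 phi0 mulr0.
have d0 : 0 < enorm (x - y) by rewrite enorm_gt0 subr_eq0.
apply: le_trans (radial_map_lip y x0) _.
have dx : enorm (x - y) <= 2 * enorm x by have := enormD x (- y); rewrite enormN; lra.
have d2 : 0 < enorm (x - y) / 2 by lra.
have dx2 : enorm (x - y) / 2 <= enorm x by lra.
have g1 := gam_le n_ge2 d2 dx2.
have p1 : phi (enorm (x - y) / 2) <= phi (enorm (x - y)) by apply: (phi_le n_ge2); lra.
have E := gamM (n := n) d2.
have h : gam (enorm x) * enorm (x - y) <= 2 * phi (enorm (x - y)) by nra.
have : c^-1 * (gam (enorm x) * enorm (x - y)) <= c^-1 * (2 * phi (enorm (x - y))).
  by rewrite ler_wpM2l// ltW.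
lra.
Qed.

End sign.
End radial_map.

(** * Local integrability of [phi |x| / |x|] *)

Section gam_integrable.
Context {R : realType} {n : nat}.
Hypothesis n_ge2 : (2 <= n)%N.
Local Notation mu := (lebesgue_rV R n).
Local Notation phi := (@phi_modulus R n).
Local Notation gam := (@gam R n).
Local Notation e := (expR 1 : R).

Lemma measurable_phi : measurable_fun setT phi.
Proof.
have -> : phi = (fun s => if s <= 0 then 0 else if s <= 1 then
    (1 - ln s) `^ (- n%:R^-1) * (ln (e - ln s)) `^ (-1) else s).
  apply/funext => s; rewrite /phi_modulus; case: ifPn => //; rewrite -ltNge => s0.
  case: ifPn => // s1; rewrite !ln_div ?posrE ?expR_gt0// !expRK powR_inv1//.
  have := ln_le0 s1; have := @e_ge2 R => e2 l0.
  by rewrite ln_ge0//; lra.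
have ml : measurable_fun setT (fun s : R => 1 - ln s) by apply: measurable_funB.
have ml' : measurable_fun setT (fun s : R => ln (e - ln s)).
  by apply: (measurableT_comp (@measurable_ln R)); apply: measurable_funB.
have mle (a : R) : measurable_fun setT (fun s : R => s <= a) by apply: measurable_fun_ler.
apply: (measurable_fun_ifT (T1 := R) (T2 := R) (g := cst 0) (f := fun s : R => s <= 0)) => //.
apply: (measurable_fun_ifT (T1 := R) (T2 := R) (h := id) (f := fun s : R => s <= 1)) => //.
apply: measurable_funM.
  exact: (measurableT_comp (measurable_powR _) ml).
exact: (measurableT_comp (measurable_powR _) ml').
Qed.

Lemma measurable_gam_enorm : measurable_fun setT (fun x : 'rV[R]_n => gam (enorm x)).
Proof.
rewrite (_ : (fun _ => _) = (fun x => phi (enorm x) * (enorm x `^ (-1)))); last first.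
  by apply/funext => x; rewrite powR_inv1// enorm_ge0.
apply: measurable_funM; first exact: (measurableT_comp measurable_phi measurable_enorm).
exact: (measurableT_comp (measurable_powR _) measurable_enorm).
Qed.

(** In the coordinate [t = - ln |x|] these are the unit intervals [[k, k + 1[]. *)
Definition shell (k : nat) : set 'rV[R]_n := [set x | expR (- k.+1%:R) < enorm x <= expR (- k%:R)].

Lemma measurable_shell k : measurable (shell k).
Proof.
rewrite -[X in measurable X]setTI.
exact: (measurable_enorm measurableT (measurable_itv `]expR (- k.+1%:R), expR (- k%:R)])).
Qed.

Lemma trivIset_shell : trivIset setT shell.
Proof.
apply/trivIsetP => i j _ _; wlog ij : i j / (i < j)%N.
  move=> w ij; case: (ltngtP i j) => [h|h|/eqP]; first exact: w.
    by rewrite setIC; apply: w => //; rewrite eq_sym.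
  by rewrite (negbTE ij).
move=> _; apply/seteqP; split => // x [/= /andP[xi _] /andP[_ xj]].
have : expR (- j%:R) <= expR (- i.+1%:R) :> R by rewrite ler_expR lerN2 ler_nat.
by move=> /(le_trans xj); rewrite leNgt xi.
Qed.

Lemma shell_cover x : 0 < enorm x -> enorm x <= 1 -> (\bigcup_k shell k) x.
Proof.
move=> x0 x1; have t0 : 0 <= - ln (enorm x) by rewrite oppr_ge0 ln_le0.
exists (Num.truncn (- ln (enorm x))) => //; rewrite /shell /=.
rewrite -[X in _ < X <= _]lnK ?posrE// ltr_expR ler_expR ltrNl lerNr.
by rewrite truncnS_gt truncn_le.
Qed.

(** [(2 e) ^ n] compares the cube around a shell with its inner radius; the last [e] comes from
    [e + k + 1 <= e (k + 2)]. *)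
Definition shell_bound : R := (2 * e) ^+ n * e.

Let Lk (k : nat) : R := ln (e + k%:R).

(** A discrete form of the primitive [- 1 / ln (e + t)]. Since [n >= 2] and the logarithm is at
    least 1, its [n]-th power dominates the product of two consecutive logarithms in the telescoping
    difference. *)
Lemma shell_term (k : nat) :
  (2 * expR (- k%:R)) ^+ n * gam (expR (- k.+1%:R)) ^+ n <=
  shell_bound * ((Lk k)^-1 - (Lk k.+1)^-1).
Proof.
have e2 := @e_ge2 R.
have k0 : 0 <= k%:R :> R by [].
have k0' : 0 <= k.+1%:R :> R by [].
have L1 : 1 <= Lk k.+1 by exact: ln_e_ge1.
have L0 : 1 <= Lk k by exact: ln_e_ge1.
have LL : Lk k <= Lk k.+1 by rewrite /Lk ler_ln ?posrE ?lerD2l ?ler_nat//; lra.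
have -> : (2 * expR (- k%:R)) ^+ n * gam (expR (- k.+1%:R)) ^+ n =
  (2 * e) ^+ n * ((1 + k.+1%:R) * Lk k.+1 ^+ n)^-1.
  rewrite -(phi_expRN_pow n_ge2 k0') -exprMn -[RHS]exprMn; congr (_ ^+ _).
  rewrite /gam.
  have -> : expR (- k%:R) = e * expR (- k.+1%:R) :> R.
    by rewrite -expRD -natr1; congr expR; ring.
  by field; rewrite gt_eqF// expR_gt0.
rewrite /shell_bound -mulrA ler_pM2l; last by rewrite exprn_gt0// mulr_gt0// expR_gt0.
have h1 : (e + k.+1%:R)^-1 <= Lk k.+1 - Lk k.
  have := @ln_sub_le R (e + k.+1%:R) (e + k%:R).
  have -> : (e + k%:R - (e + k.+1%:R)) / (e + k.+1%:R) = - (e + k.+1%:R)^-1.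
    by rewrite -natr1; field; lra.
  rewrite -/(Lk k) -/(Lk k.+1) => h.
  have h' : Lk k - Lk k.+1 <= - (e + k.+1%:R)^-1 by apply: h; lra.
  lra.
have h2 : (Lk k)^-1 - (Lk k.+1)^-1 = (Lk k.+1 - Lk k) / (Lk k * Lk k.+1) by field; lra.
have h3 : Lk k.+1 ^+ 2 <= Lk k.+1 ^+ n by apply: ler_weXn2l.
rewrite h2 -[leLHS]mul1r ler_pdivrMr; last by rewrite mulr_gt0// ?exprn_gt0; lra.
rewrite mulrA mulrAC ler_pdivlMr; last by rewrite mulr_gt0; lra.
have h4 : 1 <= (Lk k.+1 - Lk k) * (e + k.+1%:R) by rewrite -ler_pdivrMr ?mul1r//; lra.
have h5 : e + k.+1%:R <= e * (1 + k.+1%:R) by nra.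
have h6 : Lk k * Lk k.+1 <= Lk k.+1 ^+ n by apply: le_trans h3; rewrite expr2 ler_wpM2r//; lra.
rewrite mul1r; apply: (le_trans h6).
have -> : e * (Lk k.+1 - Lk k) * ((1 + k.+1%:R) * Lk k.+1 ^+ n) =
  (Lk k.+1 - Lk k) * (e * (1 + k.+1%:R)) * Lk k.+1 ^+ n by ring.
rewrite ler_peMl//; first by rewrite exprn_ge0//; lra.
by apply: (le_trans h4); rewrite ler_wpM2l//; lra.
Qed.

Let f (x : 'rV[R]_n) : R := gam (enorm x) ^+ n.

Let f0 x : 0 <= f x.
Proof. by rewrite exprn_ge0// gam_ge0// enorm_ge0. Qed.

Let mf : measurable_fun setT f.
Proof. exact: (measurable_funX n measurable_gam_enorm). Qed.

(** [gam] is largest at the inner radius, and the shell lies in the cube whose half-side is the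
    outer radius. *)
Lemma integral_shell k :
  (\int[mu]_(x in shell k) (f x)%:E <=
   (shell_bound * ((Lk k)^-1 - (Lk k.+1)^-1))%:E)%E.
Proof.
have mS := measurable_shell k.
apply: (@le_trans _ _ (\int[mu]_(x in shell k) (gam (expR (- k.+1%:R)) ^+ n)%:E)%E).
  apply: ge0_le_integral => //.
  - by move=> x _; rewrite lee_fin.
  - by apply/measurable_EFinP; exact: measurable_funTS.
  - move=> x /andP[x1 x2]; rewrite lee_fin /f.
    apply: lerXn2r; rewrite ?nnegrE ?gam_ge0 ?enorm_ge0 ?expR_ge0//.
    by apply: (gam_le n_ge2); rewrite ?expR_gt0// ltW.
rewrite integral_cst//.
apply: (@le_trans _ _ ((gam (expR (- k.+1%:R)) ^+ n)%:E * ((2 * expR (- k%:R)) ^+ n)%:E)%E).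
  rewrite lee_wpmul2l ?lee_fin ?exprn_ge0 ?gam_ge0 ?expR_ge0//.
  rewrite -[leRHS](@lebesgue_cube R n) ?expR_ge0//.
  apply: le_measure; rewrite ?inE//; first exact: measurable_cube.
  by move=> x /andP[_ x2] i; apply: le_trans x2; exact: coord_le_enorm.
by rewrite -EFinM lee_fin mulrC shell_term.
Qed.

Lemma integral_unit_ball : (\int[mu]_(x in \bigcup_k shell k) (f x)%:E <= shell_bound%:E)%E.
Proof.
have mfD : measurable_fun (\bigcup_k shell k) (EFin \o f).
  by apply/measurable_EFinP; exact: measurable_funTS.
have fD0 x : (\bigcup_k shell k) x -> (0 <= (EFin \o f) x)%E by move=> _; rewrite lee_fin.
rewrite (ge0_integral_bigcup _ measurable_shell mfD fD0 trivIset_shell).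
have t0 k : (0 <= \int[mu]_(x in shell k) (f x)%:E)%E.
  by apply: integral_ge0 => x _; rewrite lee_fin.
apply: lime_le; first by apply: is_cvg_nneseries.
apply: nearW => N.
apply: (@le_trans _ _ (\sum_(0 <= k < N) (shell_bound * ((Lk k)^-1 - (Lk k.+1)^-1))%:E)%E).
  by apply: lee_sum => k _; exact: integral_shell.
rewrite sumEFin lee_fin -mulr_sumr.
have -> : \sum_(0 <= k < N) ((Lk k)^-1 - (Lk k.+1)^-1) = (Lk 0)^-1 - (Lk N)^-1.
  rewrite -[LHS]opprK -sumrN (eq_bigr (fun k => (Lk k.+1)^-1 - (Lk k)^-1)); last first.
    by move=> k _; rewrite opprB.
  by rewrite (@telescope_sumr _ 0 N (fun k => (Lk k)^-1))// opprB.
have L1 : 1 <= Lk N by exact: ln_e_ge1.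
have L0 : Lk 0 = 1 by rewrite /Lk addr0 expRK.
rewrite L0 invr1 ler_piMr//.
  by rewrite mulr_ge0 ?exprn_ge0 ?mulr_ge0 ?expR_ge0.
have : 0 <= (Lk N)^-1 by rewrite invr_ge0; lra.
lra.
Qed.

Lemma gam_enorm_locally_Lp : locally_Lp setT n%:R (fun x : 'rV[R]_n => gam (enorm x)).
Proof.
split; first exact: measurable_gam_enorm.
move=> K cK _; have mK := compact_measurable_rV cK.
have mD : measurable (\bigcup_k shell k) by apply: bigcupT_measurable => k; exact: measurable_shell.
under eq_integral => x _ do rewrite powR_mulrn// (ger0_norm (gam_ge0 (n := n) (enorm_ge0 x))).
have fi : (0 <= \int[mu]_(x in \bigcup_k shell k) (f x)%:E)%E.
  by apply: integral_ge0 => x _; rewrite lee_fin.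
have mr : measurable_fun setT ((EFin \o f) \_ (\bigcup_k shell k)).
  by apply/(measurable_restrictT _ mD).1; apply: measurable_funTS; exact/measurable_EFinP.
have mrK : measurable_fun K ((EFin \o f) \_ (\bigcup_k shell k)) by exact: measurable_funTS.
have r0 x : (0 <= ((EFin \o f) \_ (\bigcup_k shell k)) x)%E.
  by rewrite patchE; case: ifPn => // _; rewrite lee_fin.
(* Off the shells the integrand is at most 1: [gam] is 1 outside the unit ball and has the value 0
   at the origin by convention. *)
apply: (@le_lt_trans _ _ (\int[mu]_(x in K) (1%:E + ((EFin \o f) \_ (\bigcup_k shell k)) x))%E).
  apply: ge0_le_integral => //.
  - by move=> x _; rewrite lee_fin; exact: f0.
  - by apply/measurable_EFinP; exact: measurable_funTS.
  - exact: emeasurable_funD.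
  - move=> x Kx; rewrite patchE; case: ifPn => xD; first by rewrite -EFinD lee_fin lerDr.
    rewrite adde0 lee_fin.
    have [->|x0] := eqVneq x 0.
      by rewrite enorm0 /gam phi0 mul0r expr0n; case: eqP => _; rewrite ?lexx ?ler01.
    rewrite -enorm_gt0 in x0; have [x1|x1] := leP (enorm x) 1.
      by move: xD; rewrite notin_setE => /(_ (shell_cover x0 x1)).
    by rewrite /gam (phi_ge1 (ltW x1)) divff ?expr1n// gt_eqF.
rewrite ge0_integralD//; apply: lte_add_pinfty.
  by rewrite integral_cst// mul1e; exact: compact_lty.
apply: (@le_lt_trans _ _ (\int[mu]_x ((EFin \o f) \_ (\bigcup_k shell k)) x)%E).
  exact: ge0_subset_integral.
by rewrite -integral_mkcond (le_lt_trans integral_unit_ball)// ltry.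
Qed.
End gam_integrable.

(** * The bi-conformal deformation *)

Lemma is_maximum_get {R : realType} (A : set R) (m : R) : is_maximum A m ->
  [get m' | is_maximum A m'] = m.
Proof.
move=> [Am mA]; have [Ag gA] := @getPex _ (is_maximum A) (ex_intro _ m (conj Am mA)).
by apply/le_anti; rewrite mA//= gA.
Qed.

Section biconformal.
Context {R : realType} {n : nat}.
Hypothesis n_ge2 : (2 <= n)%N.
Variables (i0 : 'I_n) (sg : R).
Hypothesis sg1 : `|sg| = 1.
Local Notation phi := (@phi_modulus R n).
Local Notation H := (radial_map i0 sg).

Lemma continuous_radial_map : continuous H.
Proof.
move=> x; apply/(@cvgrPdist_le _ _ _ _ (nbhs_filter x)) => eps e0.
have c0 := @phi_slope_gt0 R.
(* The factor is the reciprocal of the constant in [radial_map_modulus]. *)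
have [d d0 pd] := phi_small n_ge2 (mulr_gt0 e0 (divr_gt0 c0 (ltr0n R 20))).
have nb : \forall y \near x, enorm (x - y) < d.
  have d1 : 0 < d / n%:R by rewrite divr_gt0// ltr0n; apply: leq_trans n_ge2.
  have : \forall y \near x, `|x - y| < d / n%:R.
    by have := nbhsx_ballx x _ d1; rewrite mx_norm_ball.
  apply: filterS => y; rewrite ltr_pdivlMr; last by rewrite ltr0n; apply: leq_trans n_ge2.
  by rewrite mulrC; apply: le_lt_trans; exact: enorm_le_norm.
apply: filterS nb => y xy.
rewrite (le_trans (norm_le_enorm _))// (le_trans (radial_map_modulus n_ge2 i0 sg1 x y))//.
have : phi (enorm (x - y)) <= eps * (@phi_slope R / 20).
  by apply: le_trans pd; apply: (phi_le n_ge2); rewrite ?enorm_ge0// ltW.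
move=> h; rewrite -ler_pdivlMl; last by rewrite mulr_gt0// invr_gt0.
apply: (le_trans h); rewrite le_eqVlt; apply/orP; left; apply/eqP; field; lra.
Qed.

Lemma sobolev_radial_map : sobolev_map_loc setT n%:R H.
Proof.
move=> j; set u := fun x => H x ord0 j.
pose C : R := 10 / phi_slope.
have C0 : 0 <= C by rewrite divr_ge0// ltW// phi_slope_gt0.
pose M (x : 'rV[R]_n) := C * @gam R n (enorm x).
have cu : continuous u.
  move=> x; have cH : {for x, continuous H} := @continuous_radial_map x.
  exact: (continuous_comp cH (@coord_continuous R 1 n ord0 j (H x))).
have M0 x : 0 <= M x by rewrite mulr_ge0// gam_ge0// enorm_ge0.
have uM x y : x != 0 -> `|u x - u y| <= M x * enorm (x - y).
  move=> x0; apply: le_trans (radial_map_lip n_ge2 i0 sg1 y x0).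
  have -> : u x - u y = (H x - H y) ord0 j by rewrite [RHS]mxE [X in _ = _ + X]mxE.
  exact: coord_le_enorm.
have MB (d : R) : 0 < d -> exists B, forall x, d <= enorm x -> M x <= B.
  move=> d0; exists (C * @gam R n d) => x dx; rewrite ler_wpM2l//.
  exact: gam_le.
have n1 : 1 <= n%:R :> R by rewrite ler1n; apply: leq_trans n_ge2.
have MLn : locally_Lp setT n%:R M by apply: locally_LpZ; exact: gam_enorm_locally_Lp.
have ML1 := locally_Lp1 n1 MLn.
split; first by apply: continuous_locally_Lp.
move=> i; exists (derivative_rep u i); split.
  apply: (locally_LpS _ _ _ MLn) => //; first exact: measurable_derivative_rep.
  by move=> x; rewrite (ger0_norm (M0 x)); exact: derivative_rep_le.
exact: weak_partial_derivative_rep.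
Qed.

Lemma optimal_modulus_radial_map (s : R) : 0 <= s -> optimal_modulus H 0 s = phi s.
Proof.
move=> s0; apply: is_maximum_get; split; last first.
  move=> _ [x /= xs <-]; rewrite radial_map0 subr0.
  by rewrite -[in leRHS]xs subr0 enorm_radial_map_le.
(* The maximum is attained at the pole of latitude [sg * sg = 1], where the stretching is by [phi].
   The case [s = 0] is separate because the latitude of the origin is 0. *)
exists (sg * s *: delta_mx ord0 i0) => /=.
  by rewrite subr0 enorm_delta normrM sg1 mul1r ger0_norm.
rewrite radial_map0 subr0 (enorm_radial_map n_ge2 i0 sg1) enorm_delta normrM sg1 mul1r ger0_norm//.
have [->|sn0] := eqVneq s 0; first by rewrite phi0 (rad_r0 n_ge2)// (latitude_le1 i0 sg1).
rewrite -[RHS]rad1; congr (rad _ _).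
rewrite /latitude enorm_delta normrM sg1 mul1r ger0_norm// !mxE !eqxx mulr1 mulrA.
have -> : sg * sg = 1 by rewrite -expr2 -real_normK ?num_real// sg1 expr1n.
by rewrite mul1r divff.
Qed.
End biconformal.

Theorem theorem1p2 (R : realType) (n : nat) (n_ge2 : (2 <= n)%N) :
  exists (C : R) (H F : 'rV[R]_n -> 'rV[R]_n),
    [/\ biconformal_deformation [set: 'rV[R]_n] [set: 'rV[R]_n] H F,
      H 0 = 0 /\ (forall x : 'rV[R]_n, 1 <= enorm x -> H x = x),
      forall x1 x2 : 'rV[R]_n,
        enorm (H x1 - H x2) <= C * phi_modulus n (enorm (x1 - x2)),
      forall y1 y2 : 'rV[R]_n,
        enorm (F y1 - F y2) <= C * phi_modulus n (enorm (y1 - y2)) &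
      forall s : R, 0 <= s ->
        optimal_modulus H 0 s = phi_modulus n s /\
        phi_modulus n s = optimal_modulus F 0 s].
Proof.
have n_gt0 : (0 < n)%N by apply: leq_trans n_ge2.
pose i0 := Ordinal n_gt0.
have s1 : `|1| = 1 :> R by rewrite normr1.
have s1' : `|-1| = 1 :> R by rewrite normrN normr1.
(* The constant is absolute: [phi_slope] does not involve [n]. *)
exists (20 / @phi_slope R), (radial_map i0 1), (radial_map i0 (-1)); split.
- split; [split| |].
  + by apply: continuous_subspaceT; exact: continuous_radial_map.
  + by apply: continuous_subspaceT; exact: continuous_radial_map.
  + by move=> x _; split => //; exact: radial_mapK.
  + by move=> x _; split => //; rewrite -[X in radial_map _ X]opprK; exact: radial_mapK.
  + exact: sobolev_radial_map.
  + exact: sobolev_radial_map.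
- by split; [exact: radial_map0|move=> x x1; exact: radial_map_ge1].
- exact: radial_map_modulus.
- exact: radial_map_modulus.
- by move=> s s0; rewrite !optimal_modulus_radial_map.
Qed.
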